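(* Let $a\in L^\infty(\mathbf R)$ be smooth, let $0\le\epsilon\le1$, and suppose that there are $g\in\mathcal G$ and a constant $k=k(n,a,g)$ independent of $R$ such that $$\int_{-R}^{R}e^{-\int_0^{x_1}a(t)\,dt}\,dx_1\le k\,R^{1-\epsilon}g(R)\quad\text{for all } R>1.$$ If $n\le 3+\epsilon$, then every monotone and asymptotically convergent classical solution $u$ of $$-\Delta u+a(x_1)\,\partial_{x_1}u=u-u^3\quad\text{in }\ \mathbf R\times\mathbf R^{n-1}=\mathbf R^n$$ is at most $2$-dimensional.
   Context: Here $n\ge2$ is an integer and $x_1$ denotes the first coordinate of $\mathbf x\in\mathbf R\times\mathbf R^{n-1}$. The class $\mathcal G$ is the set of nondecreasing functions $g:\mathbf R^+\to\mathbf R^+$ with $\int_1^\infty \frac{1}{r g(r)}\,dr=\infty$. Write also $\mathbf x=(\mathbf x''',x_n)\in\mathbf R^{n-1}\times\mathbf R$. A classical solution $u$ is monotone if $\partial_{x_n}u(\mathbf x)>0$ for all $\mathbf x\in\mathbf R^n$; it is asymptotically convergent if $\lim_{x_n\to\pm\infty}u(\mathbf x''',x_n)=\pm1$ for every $\mathbf x'''\in\mathbf R^{n-1}$ (pointwise, not necessarily uniformly). A function $u$ on $\mathbf R^n$ is at most $m$-dimensional if it depends on at most $m$ variables (up to a linear change of coordinates), i.e. there are a linear map $L:\mathbf R^n\to\mathbf R^m$ and a function $w:\mathbf R^m\to\mathbf R$ with $u=w\circ L$. *)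

(* Defs.v *)
From HB Require Import structures.
From mathcomp Require Import all_boot all_order all_algebra.
From mathcomp Require Import all_classical all_reals all_analysis.

Set Implicit Arguments.
Unset Strict Implicit.
Unset Printing Implicit Defensive.

Import Order.TTheory GRing.Theory Num.Theory.
Import numFieldNormedType.Exports.

Local Open Scope classical_set_scope.
Local Open Scope ring_scope.

Section OneVariable.
Variable R : realType.
Implicit Types a g : R -> R.

Definition smooth a : Prop := forall (k : nat) (t : R), derivable (a^`(k))%classic t 1.

(* The oriented integral of a from s to t. The library integrates over sets, so
   the case t < s needs the sign change. *)
Definition oriented_integral a (s t : R) : R :=
  if s <= t then \int[lebesgue_measure]_(r in `[s, t]) a r
  else - \int[lebesgue_measure]_(r in `[t, s]) a r.

(* The nondecreasing g : R^+ -> R^+ with divergent integral of 1 / (r g(r)) over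
   (1, oo), where R^+ is the set of positive reals; the values of g on the other
   reals are irrelevant. *)
Definition classG g : Prop :=
  [/\ forall r, 0 < r -> 0 < g r,
      forall r s, 0 < r -> r <= s -> g r <= g s
    & (\int[lebesgue_measure]_(r in `[1%R, +oo[) ((r * g r)^-1)%:E = +oo)%E].

End OneVariable.

Section SeveralVariables.
Variables (R : realType) (n : nat).
Implicit Types u : 'rV[R]_n.+1 -> R.

Definition partial (i : 'I_n.+1) u : 'rV[R]_n.+1 -> R :=
  fun x => 'D_(delta_mx 0 i) u x.

Definition laplacian u : 'rV[R]_n.+1 -> R :=
  fun x => \sum_(i < n.+1) partial i (partial i u) x.

Definition C1 u : Prop :=
  forall i, (forall x, derivable u x (delta_mx 0 i)) /\ continuous (partial i u).

Definition C2 u : Prop := C1 u /\ forall i, C1 (partial i u).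

(* The coordinates x_1 and x_n are those of index ord0 and ord_max. *)
Definition classical_solution (a : R -> R) u : Prop :=
  C2 u /\
  forall x, - laplacian u x + a (x 0 ord0) * partial ord0 u x = u x - u x ^+ 3.

Definition monotone_solution u : Prop := forall x, 0 < partial ord_max u x.

(* The point (y, t) of R^n x R, seen in R^(n+1). *)
Definition rcons_rV (y : 'rV[R]_n) (t : R) : 'rV[R]_n.+1 :=
  \row_j oapp (y 0) t (unlift ord_max j).

Definition asymptotically_convergent u : Prop :=
  forall y : 'rV[R]_n,
    (u (rcons_rV y t) @[t --> +oo] --> (1 : R)) /\
    (u (rcons_rV y t) @[t --> -oo] --> (- 1 : R)).

Definition at_most_dimensional (m : nat) u : Prop :=
  exists (L : {linear 'rV[R]_n.+1 -> 'rV[R]_m}) (w : 'rV[R]_m -> R), u = w \o L.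

End SeveralVariables.

(* Main.v *)
Require Import Defs.
From HB Require Import structures.
From mathcomp Require Import all_boot all_order all_algebra.
From mathcomp Require Import all_classical all_reals all_analysis.
From mathcomp Require Import ring lra measurable_realfun ess_sup_inf.
Set Implicit Arguments.
Unset Strict Implicit.
Unset Printing Implicit Defensive.
Import Order.TTheory GRing.Theory Num.Theory.
Import numFieldNormedType.Exports.
Local Open Scope classical_set_scope.
Local Open Scope ring_scope.

(** The argument is the one of Berestycki, Caffarelli and Nirenberg for De Giorgi's
    conjecture, carried out with a weight. Put [w x = exp (- int_0^(x_1) a)]; the
    equation then reads [div (w grad u) = - w (u - u^3)], and since [w] only depends on
    the first coordinate, every derivative [partial i u] in another coordinate solves
    the same linearized equation [div (w grad v) = - w (1 - 3 u^2) v]. The derivative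
    [partial n u] is a positive solution, so the quotient
    [slope = partial i u / partial n u] solves [div (w (partial n u)^2 grad slope) = 0].
    If all these quotients are constant, [u] depends only on [x_1] and on one linear
    combination of the other coordinates ([two_dimensional_of_gradient]).

    The quotients are constant by a Liouville argument ([slope_gradient_eq0]). Let
    [A j] be the weighted Dirichlet energy of a quotient at scale [2^j]. Caccioppoli's
    inequality ([local_energy_step]) bounds [A (j+1)^2] by a multiple of
    [A (j+1) - A j] times the integral of [w (partial i u)^2 |grad cutoff|^2], and that
    integral is at most a constant times [g (2^(j+5))]. Hence [1 / A j - 1 / A (j+1)] is at least a
    constant times [1 / g (2^(j+5))] ([inverse_gap]). The sum of these is infinite
    because [g] is in the class [G] ([classG_sum_unbounded]), which is impossible if
    some [A j] is positive.

    The bound on the weighted integral of [|grad u|^2] at scale [r] comes from sliding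
    [u] upwards, after Ambrosio and Cabre ([energy_le_flux]). The translates of [u]
    tend to the constant [1], whose energy is zero. The energy lost on the way is a flux
    across the boundary of the region. As [grad u] is bounded, this flux is controlled by
    the integral of the positive function [partial n u] over the sliding parameter, that
    is, by the oscillation of [u]. The energy is therefore of the order of the weighted
    volume divided by [r]; the growth of the integral of [w] and the restriction on the
    dimension make the resulting error term [O (g)] ([weighted_volume_le]).

    The gradient bound ([gradient_bound]) is obtained from the maximum principle applied
    to increments of [u]. Thus second derivatives of [u] are never differentiated, and
    only integrals of continuous functions over a cube are needed, through four
    properties: linearity, positivity, bounds for product functions, and the vanishing of
    the integral of a partial derivative of a function that vanishes outside of the
    cube. A limit of Riemann sums along an ultrafilter has these properties
    ([integral]). *)

(** * Functions with continuous partial derivatives *)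

Lemma choice2 (A B : Type) (P Q : A -> B -> Prop) :
  (forall x, exists2 y, P x y & Q x y) ->
  exists f, forall x, P x (f x) /\ Q x (f x).
Proof.
move=> h; have /choice[f hf] : forall x, exists y, P x y /\ Q x y.
  by move=> x; have [y Py Qy] := h x; exists y.
by exists f.
Qed.

Section Gradients.
Variables (R : realType) (n : nat).
Local Notation V := 'rV[R]_n.+1.
Local Notation e j := (@delta_mx R 1 n.+1 0 j).
Implicit Types (F H : V -> R) (G K : 'I_n.+1 -> V -> R) (x y v : V).

Lemma rV_norm_le x (r : R) : 0 <= r -> (`|x| <= r) <-> (forall j, `|x 0 j| <= r).
Proof.
move=> r0; rewrite (_ : `|x| = mx_norm x) // mx_normrE; split.
  by move=> h j; apply: le_trans h; apply/bigmax_geP; right; exists (0, j).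
by move=> h; apply/bigmax_leP; split=> // -[i j] _ /=; rewrite ord1.
Qed.

Lemma rV_coord_le x j : `|x 0 j| <= `|x|.
Proof. by have [+ _] := rV_norm_le x (normr_ge0 x); apply. Qed.

(** The gradient is a parameter, so that the closure lemmas compute the gradient of a
    compound expression at the same time as they prove that it is of class C^1. *)
Definition has_gradient F G : Prop :=
  [/\ continuous F, forall j, continuous (G j)
    & forall j x, is_derive x (e j) F (G j x)].

Lemma is_derive_line F x v t d :
  is_derive (x + t *: v) v F d -> is_derive t (1 : R) (fun s => F (x + s *: v)) d.
Proof.
move=> [h1 h2].
have E : (fun h : R => h^-1 *: (F (x + (h *: 1 + t) *: v) - F (x + t *: v))) =
         (fun h : R => h^-1 *: (F (h *: v + (x + t *: v)) - F (x + t *: v))).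
  apply/funext => h; congr (_ *: (F _ - _)).
  by rewrite addrCA -scalerDl /GRing.scale /= mulr1.
have D : derivable (fun s : R => F (x + s *: v)) t 1.
  by rewrite /derivable /= E; exact: h1.
apply: DeriveDef => //.
by rewrite -h2 /derive /= E.
Qed.

Lemma is_derive_translate F y v w d :
  is_derive (y + w) v F d -> is_derive y v (fun z => F (z + w)) d.
Proof.
move=> [h1 h2].
have E : (fun s : R => s^-1 *: (F (s *: v + y + w) - F (y + w)))
  = (fun s : R => s^-1 *: (F (s *: v + (y + w)) - F (y + w))).
  by apply/funext => s; rewrite addrA.
by apply: DeriveDef; [rewrite /derivable /= E|rewrite -h2 /derive /= E].
Qed.

Lemma mean_value_line F (DF : V -> R) x v (h : R) :
  (forall t, is_derive (x + t *: v) v F (DF (x + t *: v))) ->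
  exists2 s, `|s| <= `|h| & F (x + h *: v) - F x = h * DF (x + s *: v).
Proof.
move=> dF.
have dl (t : R) : is_derive t (1 : R) (fun s => F (x + s *: v)) (DF (x + t *: v)).
  exact: is_derive_line.
have cl : continuous (fun s : R => F (x + s *: v)).
  move=> t; apply: differentiable_continuous; apply/derivable1_diffP.
  by case: (dl t).
have [h0|h0] := leP 0 h.
  have [c cI E] := MVT_segment h0 (fun t _ => dl t) (continuous_subspaceT cl).
  exists c.
    by move: cI; rewrite in_itv /= => /andP[c0 ch]; rewrite !ger0_norm.
  by move: E; rewrite scale0r addr0 subr0 mulrC.
have [c cI E] := MVT_segment (ltW h0) (fun t _ => dl t) (continuous_subspaceT cl).
exists c.
  move: cI; rewrite in_itv /= => /andP[ch c0].
  by rewrite !ler0_norm ?lerN2 ?(ltW h0).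
move: E; rewrite scale0r addr0 sub0r => E.
by rewrite -[LHS]opprB E mulrN opprK mulrC.
Qed.

(** Moving from [x] to [x + v] one coordinate at a time and applying the mean value
    theorem on each leg; this replaces Frechet differentiability throughout. *)
Lemma mean_value_coordinates F G x v :
  (forall j y, is_derive y (e j) F (G j y)) ->
  exists2 xi : 'I_n.+1 -> V, (forall j, `|xi j - x| <= `|v|)
    & F (x + v) - F x = \sum_j v 0 j * G j (xi j).
Proof.
move=> dF.
pose p (k : nat) : V := \row_j (x 0 j + (if (j < k)%N then v 0 j else 0)).
have pS (j : 'I_n.+1) : p j.+1 = p j + v 0 j *: e j.
  apply/rowP => l; rewrite !mxE /= eq_sym ltnS leq_eqVlt.
  have [<-|nlj] := eqVneq l j.
    by rewrite eqxx /= ltnn addr0 mulr1.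
  by rewrite -val_eqE /= in nlj; rewrite (negbTE nlj) /= mulr0 addr0.
have [s hs] := choice2 (fun j : 'I_n.+1 =>
    @mean_value_line F (G j) (p j) (e j) (v 0 j) (fun t => dF j _)).
exists (fun j : 'I_n.+1 => p j + s j *: e j).
  move=> j; apply/rV_norm_le; first exact: normr_ge0.
  move=> l; rewrite !mxE /= eq_sym.
  rewrite addrAC [x 0 l + _]addrC addrK.
  have [<-|nlj] := eqVneq l j.
    rewrite ltnn add0r mulr1; have [h _] := hs l.
    exact: le_trans h (rV_coord_le _ _).
  rewrite mulr0 addr0; case: ifP => _; first exact: rV_coord_le.
  by rewrite normr0.
rewrite (_ : x + v = p n.+1); last by apply/rowP => j; rewrite !mxE ltn_ord.
rewrite (_ : F x = F (p 0)); last first.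
  by congr F; apply/rowP => j; rewrite !mxE addr0.
rewrite -(telescope_sumr (fun k => F (p k))) // big_mkord.
apply: eq_bigr => j _; rewrite pS.
by have [_ ->] := hs j.
Qed.

Lemma continuous_ball_le F x (eps : R) : continuous F -> 0 < eps ->
  exists2 d, 0 < d & forall y, `|y - x| <= d -> `|F y - F x| <= eps.
Proof.
move=> cF eps0.
have /cvgrPdist_le /(_ _ eps0) := cF x.
move=> /nbhs_normP[d /= d0 hd].
exists (d / 2); first by rewrite divr_gt0.
move=> y hy; rewrite distrC; apply: hd => /=.
by rewrite /ball_ /= distrC (le_lt_trans hy) // ltr_pdivrMr // ltr_pMr // ltr1n.
Qed.

Lemma ball_le_continuous F :
  (forall x (eps : R), 0 < eps ->
    exists2 d, 0 < d & forall y, `|y - x| <= d -> `|F y - F x| <= eps) ->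
  continuous F.
Proof.
move=> h x; apply/(@cvgrPdist_le _ _ _ _ (nbhs_filter x)) => eps eps0.
have [d d0 hd] := h x _ eps0.
apply: (iffRL (nbhs_normP x _)); exists d => //= y; rewrite /ball_ /= => hy.
by rewrite distrC hd // distrC ltW.
Qed.

(** Partial derivatives that are continuous are locally bounded, which makes the function
    locally Lipschitz. *)
Lemma derive_continuous F G :
  (forall j y, is_derive y (e j) F (G j y)) -> (forall j, continuous (G j)) ->
  continuous F.
Proof.
move=> dF cG; apply: ball_le_continuous => x eps eps0.
have [d hd] := choice2 (fun j => @continuous_ball_le (G j) x 1 (cG j) ltr01).
pose C := 1 + \sum_j (`|G j x| + 1).
have S0 : 0 <= \sum_j (`|G j x| + 1).
  by apply: sumr_ge0 => j _; rewrite addr_ge0.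
have C0 : 0 < C by rewrite ltr_pwDl.
pose d0 := \big[Num.min/eps / C]_j d j.
have d00 : 0 < d0.
  by apply: lt_bigmin => [|j _]; [rewrite divr_gt0|have [] := hd j].
exists d0 => // y hy.
have [xi hxi] := mean_value_coordinates x (y - x) dF.
rewrite (addrC x) subrK => ->.
apply: le_trans (ler_norm_sum _ _ _) _.
apply: (@le_trans _ _ (\sum_j d0 * (`|G j x| + 1))).
  apply: ler_sum => j _; rewrite normrM; apply: ler_pM => //.
    exact: le_trans (rV_coord_le _ _) hy.
  have [_ h] := hd j.
  have : `|G j (xi j) - G j x| <= 1.
    apply: h; apply: le_trans (hxi j) _; apply: le_trans hy _.
    by apply: bigmin_le_cond.
  have := ler_normD (G j (xi j) - G j x) (G j x); rewrite subrK; lra.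
rewrite -mulr_sumr.
apply: (@le_trans _ _ (eps / C * C)); last by rewrite divfK ?gt_eqF.
apply: ler_pM => //; first exact: ltW.
  exact: bigmin_le_id.
by rewrite lerDr.
Qed.

Lemma mixed_partials F G (K : 'I_n.+1 -> 'I_n.+1 -> V -> R) i j x :
  (forall k y, is_derive y (e k) F (G k y)) ->
  (forall k l y, is_derive y (e l) (G k) (K k l y)) ->
  (forall k l, continuous (K k l)) ->
  K i j x = K j i x.
Proof.
move=> dF dG cK.
(* the second difference quotient of F is a value of either mixed derivative *)
have key k l (h : R) : exists2 y, `|y - x| <= `|h| + `|h| &
    F (x + h *: e k + h *: e l) - F (x + h *: e k) - F (x + h *: e l) + F x
    = h * (h * K k l y).
  have dP y : is_derive y (e k) (fun z => F (z + h *: e l) - F z)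
                (G k (y + h *: e l) - G k y).
    apply: (@is_deriveB R V R (fun z => F (z + h *: e l)) F).
    exact: is_derive_translate.
  have [s hs Es] := @mean_value_line _ (fun y => G k (y + h *: e l) - G k y) x (e k) h
      (fun t => dP (x + t *: e k)).
  have [s' hs' Es'] := @mean_value_line (G k) (K k l) (x + s *: e k) (e l) h
      (fun t => dG _ _ _).
  exists (x + s *: e k + s' *: e l).
    rewrite addrAC [x + _]addrC addrK.
    apply: le_trans (ler_normD _ _) _; rewrite !normrZ.
    have e1 q : `|e q| <= 1.
      apply/rV_norm_le => // r; rewrite mxE /=.
      by case: (_ == _); rewrite ?normr1 ?normr0.
    apply: lerD.
      by rewrite -[leRHS]mulr1; apply: ler_pM.
    by rewrite -[leRHS]mulr1; apply: ler_pM.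
  rewrite -Es' -Es; ring.
apply/eqP; rewrite -subr_eq0 -normr_le0; apply/ler_addgt0Pr => eps eps0.
have e20 : 0 < eps / 2 by rewrite divr_gt0.
have [d1 d10 h1] := continuous_ball_le x (cK i j) e20.
have [d2 d20 h2] := continuous_ball_le x (cK j i) e20.
pose h := Num.min d1 d2 / 2.
have h0 : 0 < h by rewrite divr_gt0 // lt_min d10.
have [y hy Ey] := key i j h.
have [z hz Ez] := key j i h.
have hh : `|h| + `|h| = Num.min d1 d2 by rewrite gtr0_norm // /h; field.
have E : K i j y = K j i z.
  have : h * (h * K i j y) = h * (h * K j i z).
    rewrite -Ey -Ez [x + h *: e j + _]addrAC; ring.
  by move=> /(mulfI (lt0r_neq0 h0)) /(mulfI (lt0r_neq0 h0)).
have := h1 y; rewrite hh in hy hz.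
move=> /(_ (le_trans hy _)); rewrite ge_min lexx => /(_ isT) {}h1.
have := h2 z; move=> /(_ (le_trans hz _)); rewrite ge_min lexx orbT => /(_ isT) {}h2.
rewrite add0r.
have -> : K i j x - K j i x = (K j i z - K j i x) - (K i j y - K i j x).
  by rewrite E; ring.
apply: le_trans (ler_normB _ _) _; lra.
Qed.

End Gradients.

(** * An integral for continuous functions on a cube *)

Lemma ultra_pushforward (S T : Type) (f : S -> T) (F : set_system S) :
  UltraFilter F -> UltraFilter (f @ F).
Proof.
move=> uF; split; first exact: fmap_proper_filter.
move=> G pG FG; apply/seteqP; split => // A GA.
have [//|FA] := in_ultra_setVsetC (f @^-1` A) uF.
have GC : G (~` A) by exact: FG.
exfalso; apply: (@filter_not_empty _ G _).
by rewrite -(setICr A); exact: filterI.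
Qed.

Section ContinuousFunctions.
Variables (R : realType) (T : topologicalType).
Implicit Types F G : T -> R.

Lemma continuous_addf F G : continuous F -> continuous G ->
  continuous (fun x => F x + G x).
Proof. by move=> cF cG x; apply: (continuousD (cF x) (cG x)). Qed.

Lemma continuous_oppf F : continuous F -> continuous (fun x => - F x).
Proof. by move=> cF x; apply: (continuousN (cF x)). Qed.

Lemma continuous_mulf F G : continuous F -> continuous G ->
  continuous (fun x => F x * G x).
Proof. by move=> cF cG x; apply: (continuousM (cF x) (cG x)). Qed.

Lemma continuous_expf F k : continuous F -> continuous (fun x => F x ^+ k).
Proof.
move=> cF; elim: k => [|k IH].
  by rewrite (_ : (fun _ => _) = cst 1); [exact: cst_continuous|apply/funext => x].
rewrite (_ : (fun _ => _) = (fun x => F x * F x ^+ k)).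
  exact: continuous_mulf.
by apply/funext => x; rewrite exprS.
Qed.

Lemma continuous_cstf (c : R) : continuous (fun _ : T => c).
Proof. exact: cst_continuous. Qed.

Lemma continuous_sumf (p : nat) (Fs : 'I_p -> T -> R) :
  (forall j, continuous (Fs j)) -> continuous (fun x => \sum_(j < p) Fs j x).
Proof.
move=> cF; elim: p Fs cF => [|p IH] Fs cF.
  rewrite (_ : (fun _ => _) = cst 0); first exact: cst_continuous.
  by apply/funext => x; rewrite big_ord0.
rewrite (_ : (fun _ => _) = (fun x =>
    (\sum_(j < p) Fs (widen_ord (leqnSn p) j) x) + Fs ord_max x)).
  by apply: continuous_addf; [exact: IH|exact: cF].
by apply/funext => x; rewrite big_ord_recr.
Qed.

Lemma continuous_compf (f : R -> R) F : continuous f -> continuous F ->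
  continuous (fun x => f (F x)).
Proof. by move=> cf cF x; apply: continuous_comp; [exact: cF|exact: cf]. Qed.

End ContinuousFunctions.

Section ContinuousFunctionsOnRows.
Variables (R : realType) (n : nat).
Local Notation V := 'rV[R]_n.+1.

Lemma continuous_coord j : continuous (fun x : V => x 0 j).
Proof. exact: coord_continuous. Qed.

Lemma continuous_translate (F : V -> R) (v : V) :
  continuous F -> continuous (fun x : V => F (x + v)).
Proof.
move=> cF x; apply: (@continuous_comp _ _ _ (fun x : V => x + v) F); last exact: cF.
by apply: (@continuousD _ _ _ id (cst v) x); [exact: cvg_id|exact: cst_continuous].
Qed.

End ContinuousFunctionsOnRows.

(* Continuity of an expression built from sums, products, powers and translations,
   from the hypotheses on its leaves. The cases are chosen by the syntax of the goal:
   letting unification find them would unfold derivatives. *)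
Ltac cts :=
  lazymatch goal with
  | |- continuous (fun x => (@?f x) + (@?g x)) => apply: (@continuous_addf _ _ f g); cts
  | |- continuous (fun x => - (@?f x)) => apply: (@continuous_oppf _ _ f); cts
  | |- continuous (fun x => (@?f x) * (@?g x)) => apply: (@continuous_mulf _ _ f g); cts
  | |- continuous (fun x => (@?f x) ^+ ?k) => apply: (@continuous_expf _ _ f k); cts
  | |- continuous (fun _ => ?c) => exact: continuous_cstf
  | |- continuous (fun x => ?F (x + ?v)) => apply: (@continuous_translate _ _ F v); cts
  | |- continuous (fun x => partial ?j (partial ?i ?u) x) =>
      change (continuous (partial j (partial i u))); cts
  | |- continuous (fun x => partial ?i ?u x) => change (continuous (partial i u)); cts
  | |- continuous (partial ?j (partial ?i ?u)) =>
      match goal with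
      | H : forall k l, continuous (partial l (partial k u)) |- _ => exact (H i j)
      end
  | |- continuous (partial ?i ?u) =>
      match goal with
      | H : forall k, continuous (partial k u) |- _ => exact (H i)
      end
  | |- _ =>
    first [ assumption
          | match goal with
            | H : forall _ _, continuous _ |- _ => exact (H _ _)
            | H : forall _, continuous _ |- _ => exact (H _)
            end
          | exact: continuous_coord
          | apply: continuous_sumf => ?; cts ]
  end.

Section Integral.
Variables (R : realType) (n : nat).
Local Notation V := 'rV[R]_n.+1.
Local Notation e j := (@delta_mx R 1 n.+1 0 j).
Implicit Types (F G H w : V -> R) (x y v : V).

Lemma compact_box (L : R) : compact [set x : V | `|x| <= L].
Proof.
apply: bounded_closed_compact.
  exists L; split; first exact: num_real.
  by move=> M LM x /= /le_trans; apply; exact: ltW.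
rewrite (_ : [set x | _] = [set x : V | closed_ball_ Num.norm 0 L x]).
  exact: closed_closed_ball_.
by apply/seteqP; split => x; rewrite /closed_ball_ /= sub0r normrN.
Qed.

Lemma uniformly_continuous_box G (L eps : R) : continuous G -> 0 < eps ->
  exists2 d, 0 < d &
    forall x y, `|x| <= L -> `|y - x| <= d -> `|G y - G x| <= eps.
Proof.
move=> cG eps0.
have /compact_near_coveringP cov := @compact_box L.
have H : \forall d \near (0 : R)^'+, [set x : V | `|x| <= L] `<=`
    [set x | forall y, `|y - x| <= d -> `|G y - G x| <= eps].
  apply: cov => x _.
  have [d d0 hd] := continuous_ball_le x cG (divr_gt0 eps0 (ltr0n _ 2)).
  have d20 : 0 < d / 2 by rewrite divr_gt0.
  exists ([set x' : V | `|x - x'| < d / 2], [set r : R | r < d / 2]) => /=.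
    split; first by apply: (iffRL (nbhs_normP x _)); exists (d / 2).
    exact: nbhs_right_lt.
  move=> [x' r] /= [hx hr] y hy; rewrite distrC in hx.
  have h1 : `|G x' - G x| <= eps / 2 by apply: hd; apply: le_trans (ltW hx) _; lra.
  have h2 : `|G y - G x| <= eps / 2.
    apply: hd; rewrite -(subrKA x').
    by apply: le_trans (ler_normD _ _) _; move: (ltW hx) (ltW hr) hy; lra.
  have -> : G y - G x' = (G y - G x) - (G x' - G x) by ring.
  by apply: le_trans (ler_normB _ _) _; lra.
near (0 : R)^'+ => d; exists d; first by near: d; exact: nbhs_right_gt.
by move=> x y hx; move: (near H d); apply.
Unshelve. all: by end_near. Qed.

Lemma bounded_box G (L : R) : continuous G ->
  exists2 B, 0 <= B & forall x, `|x| <= L -> `|G x| <= B.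
Proof.
move=> cG; have [L0|L0] := leP 0 L; last first.
  exists 0 => // x hx; have := le_lt_trans hx L0.
  by rewrite ltNge normr_ge0.
have [||x _ hx] := @compact_EVT_max _ R (fun x => `|G x|) _ _ (@compact_box L).
- by exists 0 => /=; rewrite normr0.
- by apply: continuous_subspaceT => x; apply: (continuous_comp (cG x)); exact: norm_continuous.
by exists `|G x| => // y hy; apply: hx; rewrite inE.
Qed.

Lemma uniform_difference_quotient F G v (L eps : R) : continuous G ->
  (forall x, is_derive x v F (G x)) -> 0 < eps ->
  exists2 d, 0 < d & forall x (h : R), `|x| <= L -> `|h| <= d ->
    `|F (x + h *: v) - F x - h * G x| <= eps * `|h|.
Proof.
move=> cG dF eps0.
have [d d0 hd] := uniformly_continuous_box L cG eps0.
have v10 : 0 < `|v| + 1 by rewrite ltr_wpDl.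
exists (d / (`|v| + 1)); first by rewrite divr_gt0.
move=> x h hx hh.
have [s hs ->] := @mean_value_line _ _ F G x v h (fun t => dF _).
rewrite -mulrBr normrM mulrC; apply: ler_pM => //.
apply: hd => //; rewrite addrC addKr normrZ.
apply: (@le_trans _ _ (d / (`|v| + 1) * (`|v| + 1))); last by rewrite divfK ?gt_eqF.
by apply: ler_pM => //; [exact: le_trans hs hh|rewrite lerDl].
Qed.

Variable L : R.
Hypothesis L0 : 0 < L.

Definition mesh (N : nat) : R := 2 * L / N.+1%:R.
Definition node (N k : nat) : R := - L + mesh N * k%:R.
Definition grid_point (N : nat) (k : {ffun 'I_n.+1 -> 'I_N.+1}) : V :=
  \row_j node N (k j).
Definition riemann_sum F (N : nat) : R :=
  mesh N ^+ n.+1 * \sum_(k : {ffun 'I_n.+1 -> 'I_N.+1}) F (grid_point k).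

(** Along an ultrafilter every bounded sequence converges. The limit of Riemann sums thus
    exists and is linear at once, without comparing grids of different meshes. *)
Definition index_ultrafilter : set_system nat :=
  projT1 (cid (ultraFilterLemma eventually_filter)).

Definition integral F : R := lim (riemann_sum F @ index_ultrafilter).

Lemma index_ultrafilterP : UltraFilter index_ultrafilter /\ \oo `<=` index_ultrafilter.
Proof. exact: (projT2 (cid (ultraFilterLemma eventually_filter))). Qed.

Local Instance index_ultra : UltraFilter index_ultrafilter.
Proof. by have [] := index_ultrafilterP. Qed.

Lemma mesh_gt0 N : 0 < mesh N.
Proof. by rewrite /mesh divr_gt0 // mulr_gt0. Qed.

Lemma node_last N : node N N.+1 = L.
Proof. by rewrite /node /mesh divfK ?pnatr_eq0 //; ring. Qed.

Lemma node_abs_le N k : (k <= N.+1)%N -> `|node N k| <= L.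
Proof.
move=> kN; rewrite ler_norml /node lerDl mulr_ge0 ?ler0n ?(ltW (mesh_gt0 N)) //=.
have : mesh N * k%:R <= mesh N * N.+1%:R.
  by rewrite ler_pM2l ?mesh_gt0 // ler_nat.
rewrite {2}/mesh divfK ?pnatr_eq0 //; lra.
Qed.

Lemma grid_point_norm N k : `|@grid_point N k| <= L.
Proof.
apply/rV_norm_le; first exact: ltW.
by move=> j; rewrite mxE; apply: node_abs_le; exact: ltnW (ltn_ord _).
Qed.

Lemma riemann_sum_le F G N : (forall x, `|x| <= L -> F x <= G x) ->
  riemann_sum F N <= riemann_sum G N.
Proof.
move=> FG; rewrite ler_wpM2l ?exprn_ge0 ?(ltW (mesh_gt0 N)) //.
by apply: ler_sum => k _; apply: FG; exact: grid_point_norm.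
Qed.

Lemma riemann_sum_cst (c : R) N : riemann_sum (fun=> c) N = c * (2 * L) ^+ n.+1.
Proof.
rewrite /riemann_sum sumr_const card_ffun !card_ord -(mulr_natr c) natrX.
by rewrite mulrCA -exprMn /mesh divfK ?pnatr_eq0.
Qed.

Lemma riemann_sumD F G N :
  riemann_sum (fun x => F x + G x) N = riemann_sum F N + riemann_sum G N.
Proof. by rewrite /riemann_sum big_split mulrDr. Qed.

Lemma riemann_sumZ (c : R) F N :
  riemann_sum (fun x => c * F x) N = c * riemann_sum F N.
Proof. by rewrite /riemann_sum -mulr_sumr mulrCA. Qed.

Lemma riemann_sum_cvg F : continuous F ->
  riemann_sum F @ index_ultrafilter --> integral F.
Proof.
move=> cF; have [B B0 hB] := bounded_box L cF.
pose C := B * (2 * L) ^+ n.+1.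
have hC N : riemann_sum F N \in `[- C, C].
  rewrite in_itv /=; apply/andP; split.
    rewrite /C -mulNr -(riemann_sum_cst _ N); apply: riemann_sum_le => x /hB.
    by rewrite ler_norml => /andP[].
  rewrite /C -(riemann_sum_cst _ N); apply: riemann_sum_le => x /hB.
  by rewrite ler_norml => /andP[].
have := @segment_compact R (- C) C; rewrite compact_ultra.
have uF : UltraFilter (riemann_sum F @ index_ultrafilter) by exact: ultra_pushforward.
move=> /(_ (riemann_sum F @ index_ultrafilter) uF) [].
  by apply: (@filterE _ index_ultrafilter) => N; exact: hC.
move=> l [_ /= cl]; rewrite /integral (cvg_lim _ cl) //.
Qed.

Lemma index_ultrafilter_near (P : set nat) : (\forall N \near \oo, P N) ->
  index_ultrafilter P.
Proof. by have [_] := index_ultrafilterP; apply. Qed.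

Lemma integral_le_of_riemann F (c : R) : continuous F ->
  (\forall N \near \oo, riemann_sum F N <= c) -> integral F <= c.
Proof.
move=> cF h; apply: (cvgr_to_le (riemann_sum_cvg cF)).
exact: index_ultrafilter_near.
Qed.

Lemma integral_ge_of_riemann F (c : R) : continuous F ->
  (\forall N \near \oo, c <= riemann_sum F N) -> c <= integral F.
Proof.
move=> cF h; apply: (cvgr_to_ge (riemann_sum_cvg cF)).
exact: index_ultrafilter_near.
Qed.

Lemma integralD F G : continuous F -> continuous G ->
  integral (fun x => F x + G x) = integral F + integral G.
Proof.
move=> cF cG; apply/cvg_lim => //.
rewrite (_ : riemann_sum _ = riemann_sum F \+ riemann_sum G).
  by apply: cvgD; exact: riemann_sum_cvg.
by apply/funext => N; rewrite riemann_sumD.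
Qed.

Lemma integralZ (c : R) F : continuous F ->
  integral (fun x => c * F x) = c * integral F.
Proof.
move=> cF; apply/cvg_lim => //.
rewrite (_ : riemann_sum _ = (fun N => c * riemann_sum F N)).
  by apply: cvgMr; exact: riemann_sum_cvg.
by apply/funext => N; rewrite riemann_sumZ.
Qed.

Lemma integralN F : continuous F -> integral (fun x => - F x) = - integral F.
Proof.
move=> cF; rewrite -mulN1r -integralZ //; congr integral.
by apply/funext => x; rewrite mulN1r.
Qed.

Lemma integralB F G : continuous F -> continuous G ->
  integral (fun x => F x - G x) = integral F - integral G.
Proof.
move=> cF cG; rewrite integralD ?integralN //; exact: continuous_oppf.
Qed.

Lemma integral_sum (p : nat) (Fs : 'I_p -> V -> R) :
  (forall j, continuous (Fs j)) ->
  integral (fun x => \sum_(j < p) Fs j x) = \sum_(j < p) integral (Fs j).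
Proof.
elim: p Fs => [|p IH] Fs cF.
  rewrite big_ord0 (_ : (fun _ => _) = (fun x : V => 0 * 0)).
    by rewrite integralZ ?mul0r //; exact: continuous_cstf.
  by apply/funext => x; rewrite big_ord0 mul0r.
rewrite big_ord_recr /= -IH // -integralD //; last exact: continuous_sumf.
by congr integral; apply/funext => x; rewrite big_ord_recr.
Qed.

Lemma integral_le F G : continuous F -> continuous G ->
  (forall x, `|x| <= L -> F x <= G x) -> integral F <= integral G.
Proof.
move=> cF cG FG; rewrite -subr_ge0 -integralB //.
apply: integral_ge_of_riemann.
  by apply: continuous_addf => //; exact: continuous_oppf.
apply: nearW => N; rewrite (_ : 0 = riemann_sum (fun=> 0) N).
  by apply: riemann_sum_le => x /FG; rewrite subr_ge0.
by rewrite riemann_sum_cst mul0r.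
Qed.

Lemma integral_ge0 F : continuous F ->
  (forall x, `|x| <= L -> 0 <= F x) -> 0 <= integral F.
Proof.
move=> cF F0; apply: integral_ge_of_riemann => //.
apply: nearW => N; rewrite (_ : 0 = riemann_sum (fun=> 0) N).
  exact: riemann_sum_le.
by rewrite riemann_sum_cst mul0r.
Qed.

Lemma integral_abs_le F (c : R) : continuous F ->
  (forall x, `|x| <= L -> `|F x| <= c) -> `|integral F| <= c * (2 * L) ^+ n.+1.
Proof.
move=> cF hF; rewrite ler_norml; apply/andP; split.
  apply: integral_ge_of_riemann => //; apply: nearW => N.
  rewrite -mulNr -(riemann_sum_cst _ N); apply: riemann_sum_le => x /hF.
  by rewrite ler_norml => /andP[].
apply: integral_le_of_riemann => //; apply: nearW => N.
rewrite -(riemann_sum_cst _ N); apply: riemann_sum_le => x /hF.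
by rewrite ler_norml => /andP[].
Qed.

(** The grid is a discrete torus: shifting its [j]-th index cyclically permutes the
    points, and wraps around only where [F] vanishes. *)
Lemma riemann_sum_shift F j N :
  (forall x, L <= `|x 0 j| -> F x = 0) ->
  riemann_sum (fun x => F (x + mesh N *: e j)) N = riemann_sum F N.
Proof.
move=> F0; congr (_ * _).
pose s (k : {ffun 'I_n.+1 -> 'I_N.+1}) :=
  [ffun l => if l == j then ordS (k l) else k l] : {ffun 'I_n.+1 -> 'I_N.+1}.
have s_inj : injective s.
  move=> k k' /ffunP E; apply/ffunP => l; have := E l; rewrite !ffunE.
  by case: ifP => // _ /ordS_inj.
rewrite [RHS](reindex_inj s_inj) /=; apply: eq_bigr => k _.
have [kN|kN] := ltnP (k j).+1 N.+1.
  congr F; apply/rowP => l; rewrite !mxE ffunE /=.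
  have [->|nlj] := eqVneq l j; last by rewrite mulr0 addr0.
  by rewrite /node /= modn_small // mulr1 -natr1; ring.
have kjN : (k j : nat) = N by apply/anti_leq/andP; split; [exact: (ltn_ord (k j))|exact: kN].
have [z1 z2] : L <= `|(grid_point k + mesh N *: e j) 0 j| /\
    L <= `|grid_point (s k) 0 j|.
  split; last by rewrite !mxE ffunE eqxx /= kjN modnn /node mulr0 addr0 normrN ler_norm.
  rewrite !mxE !eqxx mulr1 (_ : node _ _ + _ = node N (k j).+1).
    by rewrite kjN node_last ler_norm.
  by rewrite /node -natr1; ring.
by rewrite !F0.
Qed.

Lemma mesh_le (d : R) : 0 < d -> \forall N \near \oo, mesh N <= d.
Proof.
move=> d0; near=> N; rewrite /mesh ler_pdivrMr // -ler_pdivrMl //.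
apply: (@le_trans _ _ N%:R); last by rewrite ler_nat.
near: N; exact: nbhs_infty_ger.
Unshelve. all: by end_near. Qed.

(** Integration by parts in its primitive form. A difference quotient of [F] whose step is
    the mesh has a zero Riemann sum by [riemann_sum_shift], and it is uniformly close to
    the derivative. *)
Lemma integral_partial_eq0 F G j :
  continuous F -> continuous G -> (forall x, is_derive x (e j) F (G x)) ->
  (forall x, L <= `|x 0 j| -> F x = 0) ->
  integral G = 0.
Proof.
move=> cF cG dF F0; apply/eqP; rewrite -normr_le0; apply/ler_addgt0Pr => eps eps0.
rewrite add0r.
pose Q := (2 * L) ^+ n.+1.
have Q0 : 0 < Q by rewrite exprn_gt0 // mulr_gt0.
have eQ : 0 < eps / Q by rewrite divr_gt0.
have [d d0 hd] := uniform_difference_quotient L cG dF eQ.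
have key : \forall N \near \oo, `|riemann_sum G N| <= eps.
  near=> N.
  have mN : mesh N <= d by near: N; exact: mesh_le.
  pose E x := (mesh N)^-1 * (F (x + mesh N *: e j) - F x - mesh N * G x).
  have -> : riemann_sum G N = - riemann_sum E N.
    have -> : riemann_sum E N = (mesh N)^-1 *
       (riemann_sum (fun x => F (x + mesh N *: e j)) N + -1 * riemann_sum F N
         + - mesh N * riemann_sum G N).
      rewrite -!riemann_sumZ -!riemann_sumD -riemann_sumZ; congr riemann_sum.
      by apply/funext => x; rewrite /E mulN1r mulNr.
    rewrite riemann_sum_shift // mulN1r subrr add0r mulrA mulrN mulVf ?gt_eqF ?mesh_gt0 //.
    by rewrite mulN1r opprK.
  have EQ x : `|x| <= L -> `|E x| <= eps / Q.
    move=> hx; rewrite /E normrM normfV (gtr0_norm (mesh_gt0 N)) (ler_pdivrMl _ _ (mesh_gt0 N)).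
    rewrite [leRHS]mulrC; have := hd x (mesh N) hx.
    by rewrite (gtr0_norm (mesh_gt0 N)); apply.
  rewrite normrN (_ : eps = eps / Q * Q); last by rewrite divfK ?gt_eqF.
  rewrite -[X in _ <= X](riemann_sum_cst _ N).
  rewrite ler_norml -mulN1r -riemann_sumZ; apply/andP; split.
    by apply: riemann_sum_le => x /EQ; rewrite ler_norml mulN1r => /andP[].
  by apply: riemann_sum_le => x /EQ; rewrite ler_norml => /andP[].
rewrite ler_norml; apply/andP; split.
  apply: integral_ge_of_riemann => //; apply: filterS key => N.
  by rewrite ler_norml => /andP[].
apply: integral_le_of_riemann => //; apply: filterS key => N.
by rewrite ler_norml => /andP[].
Unshelve. all: by end_near. Qed.

End Integral.

Lemma is_derive_of_estimate (R : realType) (f : R -> R) (t d : R) :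
  (forall eps : R, 0 < eps -> exists2 del, 0 < del &
     forall h, `|h| <= del -> `|f (t + h) - f t - h * d| <= eps * `|h|) ->
  is_derive t (1 : R) f d.
Proof.
move=> H.
have C : (fun h : R => h^-1 *: (f (h *: 1 + t) - f t)) @ 0^' --> d.
  apply/cvgrPdist_le => eps eps0; have [del del0 hd] := H _ eps0.
  near=> h.
  have h0 : h != 0 by near: h; exact: nbhs_dnbhs_neq.
  have hn : 0 < `|h| by rewrite normr_gt0.
  have hh : `|h| <= del by near: h; apply: dnbhs0_le.
  have -> : d - h^-1 *: (f (h *: 1 + t) - f t) = - (h^-1 * (f (t + h) - f t - h * d)).
    rewrite /GRing.scale /= mulr1 [h + t]addrC; field; exact: h0.
  rewrite normrN normrM normfV mulrC ler_pdivrMr //.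
  exact: hd.
apply: DeriveDef; first by apply/cvg_ex; exists d.
exact: cvg_lim.
Unshelve. all: by end_near. Qed.

Section IntegralBounds.
Variables (R : realType) (n : nat) (L : R).
Hypothesis L0 : 0 < L.
Local Notation V := 'rV[R]_n.+1.
Local Notation e j := (@delta_mx R 1 n.+1 0 j).
Implicit Types (F G H w : V -> R) (x y v : V).

Lemma is_derive_integral w F G v (t : R) :
  continuous w -> continuous F -> continuous G ->
  (forall x, is_derive x v F (G x)) ->
  is_derive t (1 : R) (fun s => integral L (fun x => w x * F (x + s *: v)))
    (integral L (fun x => w x * G (x + t *: v))).
Proof.
move=> cw cF cG dF; apply: is_derive_of_estimate => eps eps0.
have [B B0 hB] := bounded_box L cw.
pose Q := (B + 1) * (2 * L) ^+ n.+1.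
have Q0 : 0 < Q by rewrite mulr_gt0 ?exprn_gt0 ?mulr_gt0 // ltr_wpDl.
have cT F' s : continuous F' -> continuous (fun x => F' (x + s *: v)).
  exact: continuous_translate.
have [d d0 hd] := @uniform_difference_quotient _ _ (fun x => F (x + t *: v))
  (fun x => G (x + t *: v)) v L (eps / Q) (cT _ t cG)
  (fun x => is_derive_translate (dF (x + t *: v))) (divr_gt0 eps0 Q0).
exists d => // h hh.
pose D x := w x * (F (x + (t + h) *: v) - F (x + t *: v) - h * G (x + t *: v)).
have -> : integral L (fun x => w x * F (x + (t + h) *: v)) -
    integral L (fun x => w x * F (x + t *: v)) -
    h * integral L (fun x => w x * G (x + t *: v)) = integral L D.
  rewrite -(integralZ L0); last by cts.
  rewrite -!(integralB L0); [|by cts..].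
  congr integral; apply/funext => x; rewrite /D; ring.
apply: le_trans (@integral_abs_le _ _ _ L0 _ ((B + 1) * (eps / Q * `|h|)) _ _) _.
- by rewrite /D; cts.
- move=> x hx; rewrite /D normrM; apply: ler_pM => //.
    by apply: le_trans (hB _ hx) _; rewrite lerDl.
  have := hd x h hx hh; rewrite -[x + h *: v + _]addrA -scalerDl [h + t]addrC.
  exact.
- rewrite le_eqVlt; apply/orP; left; apply/eqP; rewrite /Q; field.
  rewrite !gt_eqF ?exprn_gt0 ?mulr_gt0 //=; exact: ltr_wpDl.
Qed.

Lemma riemann_sum_prod (p : 'I_n.+1 -> R -> R) N :
  riemann_sum L (fun x => \prod_j p j (x 0 j)) N =
  \prod_j (mesh L N * \sum_(k < N.+1) p j (node L N k)).
Proof.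
rewrite big_split /= prodr_const card_ord; congr (_ * _).
rewrite bigA_distr_bigA /=; apply: eq_bigr => k _.
by apply: eq_bigr => j _; rewrite mxE.
Qed.

(** One-dimensional sums over the nodes are estimated by comparing their terms with the
    increments of a function [G], which telescope. *)
Lemma riemann_sum1_telescope (G : R -> R) N :
  \sum_(k < N.+1) (G (node L N k + mesh L N) - G (node L N k)) = G L - G (- L).
Proof.
transitivity (G (node L N N.+1) - G (node L N 0)); last first.
  by rewrite node_last /node mulr0 addr0.
rewrite -(telescope_sumr (fun k => G (node L N k))) // big_mkord.
by apply: eq_bigr => k _; congr (G _ - _); rewrite /node -natr1; ring.
Qed.

Lemma clamp_step (a b t h : R) : a <= b -> 0 <= h ->
  Num.min (Num.max (t + h) a) b - Num.min (Num.max t a) b <=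
    (if (a - h <= t) && (t <= b) then h else 0).
Proof.
move=> ab h0; rewrite !maxElt.
case: (ltP (t + h) a) => h1; case: (ltP t a) => h2; rewrite !minElt.
all: do ?[case: (ltP _ b) => ?]; case: (leP (a - h) t) => h5.
all: case: (leP t b) => h6 /=; lra.
Qed.

Lemma clamp_mono (a b : R) : {homo (fun t : R => Num.min (Num.max t a) b) : x y / x <= y}.
Proof.
move=> x y xy; rewrite !maxElt.
case: (ltP x a) => h1; case: (ltP y a) => h2; rewrite !minElt.
all: do ?[case: (ltP _ b) => ?]; lra.
Qed.

Lemma clamp_id (a b t : R) : a <= t -> t <= b -> Num.min (Num.max t a) b = t.
Proof. by move=> ta tb; rewrite max_l // min_l. Qed.

(** The bound does not involve [L]: a positive energy stays bounded away from zero while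
    the cube grows. The indicator of the ball of the maximum norm is a product, and each
    factor is compared with the increments of a clamped identity. *)
Lemma integral_ge_ball F (x0 : V) (c delta : R) :
  continuous F -> 0 <= c -> 0 < delta -> `|x0| + delta <= L ->
  (forall x, 0 <= F x) -> (forall x, `|x - x0| <= delta -> c <= F x) ->
  c * delta ^+ n.+1 <= integral L F.
Proof.
move=> cF c0 del0 x0L F0 Fc; apply: integral_ge_of_riemann => //.
near=> N.
have mN : mesh L N <= delta by near: N; exact: mesh_le.
have m0 : 0 < mesh L N by exact: mesh_gt0.
pose p (j : 'I_n.+1) (t : R) : R := if `|t - x0 0 j| <= delta then 1 else 0.
apply: (@le_trans _ _ (riemann_sum L (fun x => c * \prod_j p j (x 0 j)) N)); last first.
  apply: riemann_sum_le => // x _.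
  have [hx|hx] := leP `|x - x0| delta.
    rewrite big1 ?mulr1 ?Fc // => j _; rewrite /p.
    have := rV_coord_le (x - x0) j; rewrite !mxE => /le_trans /(_ hx) ->.
    by [].
  have [j hj] : exists j, delta < `|x 0 j - x0 0 j|.
    apply/not_existsP => H; move: hx; rewrite ltNge => /negP; apply.
    apply/rV_norm_le; first exact: ltW.
    by move=> j; rewrite !mxE leNgt; apply/negP => /H.
  have pj0 : p j (x 0 j) = 0 by rewrite /p leNgt hj.
  by rewrite (bigD1 j) //= pj0 mul0r mulr0.
rewrite riemann_sumZ riemann_sum_prod ler_wpM2l //.
rewrite (_ : delta ^+ n.+1 = \prod_(j < n.+1) delta); last first.
  by rewrite prodr_const card_ord.
apply: ler_prod => j _; rewrite (ltW del0) /=.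
pose G t := Num.min (Num.max t (x0 0 j)) (x0 0 j + delta).
have xj : `|x0 0 j| <= L - delta.
  by apply: le_trans (rV_coord_le _ _) _; lra.
have [xj1 xj2] : - (L - delta) <= x0 0 j /\ x0 0 j <= L - delta.
  by move: xj; rewrite ler_norml => /andP[].
have <- : G L - G (- L) = delta.
  rewrite /G (min_r (y := _ + _)) ?(max_l (x := L)) ?(max_r (x := - L)) ?(min_l (x := x0 0 j)); lra.
rewrite -(riemann_sum1_telescope _ N) mulr_sumr; apply: ler_sum => k _.
apply: le_trans (clamp_step _ _ _) _; [lra|lra|].
rewrite /p; case: (leP `|_|) => h; case: ifP => /= h1; rewrite ?mulr0 ?mulr1 //; try lra.
move: h1 h => /andP[h1 h2]; rewrite ltNge ler_norml => /negP; case.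
by apply/andP; split; lra.
Unshelve. all: by end_near. Qed.

(** The majorant is a product of functions of one coordinate, so its Riemann sum factors;
    [G] plays the role of a primitive of [omega] in the first factor. *)
Lemma integral_le_cube F (omega G : R -> R) (rho : R) :
  continuous F -> 0 <= rho -> (forall t, 0 <= omega t) ->
  {homo G : s t / s <= t} ->
  (forall t h : R, `|t| <= rho -> 0 < h -> h <= 1 -> h * omega t <= G (t + h) - G t) ->
  (forall x, `|x| <= rho -> F x <= omega (x 0 ord0)) ->
  (forall x, rho < `|x| -> F x <= 0) ->
  integral L F <= (G L - G (- L)) * (2 * rho + 1) ^+ n.
Proof.
move=> cF rho0 om0 Gmono Gom Fin Fout; apply: integral_le_of_riemann => //.
near=> N.
have mN : mesh L N <= 1 by near: N; exact: mesh_le.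
have m0 : 0 < mesh L N by exact: mesh_gt0.
pose p (j : 'I_n.+1) (t : R) : R :=
  if `|t| <= rho then (if j == ord0 then omega t else 1) else 0.
have p0 j t : 0 <= p j t by rewrite /p; do 2?case: ifP.
apply: (@le_trans _ _ (riemann_sum L (fun x => \prod_j p j (x 0 j)) N)).
  apply: riemann_sum_le => // x _.
  have [hx|hx] := leP `|x| rho; last first.
    by apply: le_trans (Fout _ hx) _; exact: prodr_ge0.
  apply: le_trans (Fin _ hx) _.
  have hxj j : `|x 0 j| <= rho by apply: le_trans (rV_coord_le _ _) hx.
  rewrite big_ord_recl /= big1 ?mulr1; first by rewrite /p hxj eqxx.
  by move=> j _; rewrite /p hxj.
have sp0 j : 0 <= mesh L N * \sum_(k < N.+1) p j (node L N k).
  by apply: mulr_ge0; [exact: ltW|exact: sumr_ge0].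
rewrite riemann_sum_prod big_ord_recl /=; apply: ler_pM.
- exact: sp0.
- by apply: prodr_ge0 => j _; exact: sp0.
- rewrite -(riemann_sum1_telescope _ N) mulr_sumr; apply: ler_sum => k _.
  rewrite /p eqxx; case: ifP => h; first exact: Gom.
  by rewrite mulr0 subr_ge0 Gmono // lerDl ltW.
rewrite (_ : (2 * rho + 1) ^+ n = \prod_(j < n) (2 * rho + 1)); last first.
  by rewrite prodr_const card_ord.
apply: ler_prod => j _; rewrite sp0 /=.
pose H t := Num.min (Num.max t (- rho)) (rho + 1).
apply: (@le_trans _ _ (H L - H (- L))).
  rewrite -(riemann_sum1_telescope _ N) mulr_sumr; apply: ler_sum => k _.
  rewrite /p (_ : (lift ord0 j == ord0) = false) //.
  case: ifP => h.
    move: h; rewrite ler_norml => /andP[h1 h2]; rewrite mulr1 /H !clamp_id; lra.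
  by rewrite mulr0 subr_ge0 clamp_mono // lerDl ltW.
rewrite /H !maxElt; case: (ltP L _) => h1; case: (ltP (- L) _) => h2; rewrite !minElt.
all: do ?[case: (ltP _ (rho + 1)) => ?]; lra.
Unshelve. all: by end_near. Qed.

End IntegralBounds.

Section Calculus.
Variables (R : realType) (n : nat).
Local Notation V := 'rV[R]_n.+1.
Local Notation e j := (@delta_mx R 1 n.+1 0 j).
Implicit Types (F H : V -> R) (G K : 'I_n.+1 -> V -> R) (x y v : V).

Lemma is_derive_of_line F x v d :
  is_derive (0 : R) (1 : R) (fun s => F (x + s *: v)) d -> is_derive x v F d.
Proof.
move=> [h1 h2].
have E : (fun h : R => h^-1 *: (F (x + (h *: 1 + 0) *: v) - F (x + (0 : R) *: v))) =
         (fun h : R => h^-1 *: (F (h *: v + x) - F x)).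
  apply/funext => h; congr (_ *: (F _ - F _)); last by rewrite scale0r addr0.
  by rewrite addr0 addrC /GRing.scale /= mulr1.
have D : derivable F x v by rewrite /derivable /= -E; exact: h1.
by apply: DeriveDef => //; rewrite -h2 /derive /= E.
Qed.

Lemma is_derive_compf (f : R -> R) F x v d d' :
  is_derive (F x) (1 : R) f d' -> is_derive x v F d ->
  is_derive x v (fun y => f (F y)) (d' * d).
Proof.
move=> hf hF; apply: is_derive_of_line.
apply: (@is_derive1_comp _ f (fun s => F (x + s *: v))).
  by rewrite scale0r addr0.
by apply: is_derive_line; rewrite scale0r addr0.
Qed.

Lemma is_derive_coord x v j : is_derive x v (fun y : V => y 0 j) (v 0 j).
Proof.
apply: is_derive_of_line.
have -> : (fun s : R => (x + s *: v) 0 j) = cst (x 0 j) + (v 0 j \*: (id : R -> R)).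
  by apply/funext => s; rewrite !mxE mulrC.
by apply: is_derive_eq; rewrite add0r /GRing.scale /= mulr1.
Qed.

Lemma has_gradientD F H G K : has_gradient F G -> has_gradient H K ->
  has_gradient (fun x => F x + H x) (fun j x => G j x + K j x).
Proof.
move=> [cF cG dF] [cH cK dH]; split=> [|j|j x]; do ?by cts.
by apply: (@is_deriveD _ _ _ F H).
Qed.

Lemma has_gradientN F G : has_gradient F G ->
  has_gradient (fun x => - F x) (fun j x => - G j x).
Proof.
move=> [cF cG dF]; split=> [|j|j x]; do ?by cts.
by apply: (@is_deriveN _ _ _ F).
Qed.

Lemma has_gradientM F H G K : has_gradient F G -> has_gradient H K ->
  has_gradient (fun x => F x * H x) (fun j x => F x * K j x + H x * G j x).
Proof.
move=> [cF cG dF] [cH cK dH]; split=> [|j|j x]; do ?by cts.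
by apply: (@is_deriveM _ _ F H).
Qed.

Lemma has_gradient_cst (c : R) : has_gradient (fun _ : V => c) (fun _ _ => 0).
Proof.
by split=> [|j|j x]; [exact: continuous_cstf|exact: continuous_cstf|exact: is_derive_cst].
Qed.

Lemma has_gradient_coord k :
  has_gradient (fun x : V => x 0 k) (fun j _ => (j == k)%:R).
Proof.
split=> [|j|j x]; [exact: continuous_coord|exact: continuous_cstf|].
by apply: (is_derive_eq (is_derive_coord _ _ _)); rewrite mxE eqxx /= eq_sym.
Qed.

Lemma has_gradient_comp (f f' : R -> R) F G :
  (forall t, is_derive t (1 : R) f (f' t)) -> continuous f' ->
  has_gradient F G -> has_gradient (fun x => f (F x)) (fun j x => f' (F x) * G j x).
Proof.
move=> df cf' [cF cG dF].
have cf : continuous f.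
  move=> t; apply: differentiable_continuous; apply/derivable1_diffP.
  by case: (df t).
split=> [|j|j x].
- exact: continuous_compf.
- by apply: continuous_mulf => //; exact: continuous_compf.
- exact: is_derive_compf.
Qed.

Lemma has_gradientV F G : (forall x, F x != 0) -> has_gradient F G ->
  has_gradient (fun x => (F x)^-1) (fun j x => - (F x) ^- 2 * G j x).
Proof.
move=> F0 [cF cG dF].
have cV : continuous (fun x => (F x)^-1).
  by move=> x; apply: (continuousV (F0 x) (cF x)).
split=> [//|j|j x].
  apply: continuous_mulf => //; apply: continuous_oppf.
  rewrite (_ : (fun x => _) = (fun x => (F x)^-1 * (F x)^-1)).
    exact: continuous_mulf.
  by apply/funext => x; rewrite expr2 invfM.
have [dv <-] := dF j x.
split; first exact: derivableV.
by rewrite deriveV.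
Qed.

Lemma has_gradient_eq F G K : has_gradient F G -> (forall j x, G j x = K j x) ->
  has_gradient F K.
Proof. by move=> h GK; rewrite (_ : K = G) //; apply/funext => j; apply/funext. Qed.

Lemma has_gradient_translate F G v : has_gradient F G ->
  has_gradient (fun x => F (x + v)) (fun j x => G j (x + v)).
Proof.
by move=> [cF cG dF]; split=> [|j|j x]; [cts|cts|exact: is_derive_translate].
Qed.

Lemma C1_gradient F : C1 F -> has_gradient F (fun j => partial j F).
Proof.
move=> C; have d j y : is_derive y (e j) F (partial j F y).
  by apply: derivableP; have [] := C j.
split=> // [|j]; last by have [] := C j.
by apply: (derive_continuous d) => j; have [] := C j.
Qed.

Lemma gradient_partial F G : has_gradient F G -> forall j, partial j F = G j.
Proof. by move=> [_ _ dF] j; apply/funext => x; have [_] := dF j x. Qed.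

Lemma gradient_C1 F G : has_gradient F G -> C1 F.
Proof.
move=> h j; rewrite (gradient_partial h); have [cF cG dF] := h.
by split=> // x; have [] := dF j x.
Qed.

End Calculus.

(** * The equation in divergence form *)

Section WeakForm.
Variables (R : realType) (n : nat) (L : R).
Hypothesis L0 : 0 < L.
Local Notation V := 'rV[R]_n.+1.
Local Notation e j := (@delta_mx R 1 n.+1 0 j).
Variables (a omega : R -> R).
Hypothesis a_cont : continuous a.
Hypothesis omega_derive : forall t, is_derive t (1 : R) omega (- (a t * omega t)).
Implicit Types (u xi : V -> R) (dxi : 'I_n.+1 -> V -> R) (x y v : V).

Definition weight x : R := omega (x 0 ord0).

Lemma weight_gradient :
  has_gradient weight (fun j x => - (a (x 0 ord0) * weight x) * (j == ord0)%:R).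
Proof.
have omega_cont : continuous omega.
  move=> t; apply: differentiable_continuous; apply/derivable1_diffP.
  by case: (omega_derive t).
apply: (@has_gradient_comp _ _ omega (fun t => - (a t * omega t))) => //.
  by cts.
exact: has_gradient_coord.
Qed.

Lemma solution_C1 u : classical_solution a u -> C1 u.
Proof. by case=> -[]. Qed.

Lemma solution_partial_C1 u i : classical_solution a u -> C1 (partial i u).
Proof. by case=> -[]. Qed.

Lemma solution_mixed u i j x : classical_solution a u ->
  partial i (partial j u) x = partial j (partial i u) x.
Proof.
move=> [[C C'] _].
apply: (@mixed_partials _ _ u (fun k => partial k u)
  (fun k l => partial l (partial k u)) j i x).
- by move=> k y; have [_ _] := C1_gradient C; apply.
- by move=> k l y; have [_ _] := C1_gradient (C' k); apply.
- by move=> k l; have [_ + _] := C1_gradient (C' k); apply.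
Qed.

Lemma partial_translate u v j : C1 u ->
  partial j (fun x => u (x + v)) = (fun x => partial j u (x + v)).
Proof.
move=> C; exact: (gradient_partial (has_gradient_translate v (C1_gradient C))).
Qed.

Lemma solution_translate u v : v 0 ord0 = 0 -> classical_solution a u ->
  classical_solution a (fun x => u (x + v)).
Proof.
move=> v0 [[C C'] eq].
have P j := partial_translate v j C.
split; first split.
- exact: (gradient_C1 (has_gradient_translate v (C1_gradient C))).
- move=> i; rewrite P.
  exact: (gradient_C1 (has_gradient_translate v (C1_gradient (C' i)))).
move=> x; have E : laplacian (fun x => u (x + v)) x = laplacian u (x + v).
  by apply: eq_bigr => i _; rewrite P (partial_translate _ _ (C' i)).
by rewrite E P -(eq (x + v)) !mxE v0 addr0.
Qed.

(** The weight is an integrating factor of the drift: the divergence of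
    [weight * grad u] is [weight * (laplacian u - a * partial ord0 u)]. *)
Lemma solution_weak u xi dxi : classical_solution a u -> has_gradient xi dxi ->
  (forall x, L <= `|x| -> xi x = 0) ->
  integral L (fun x => weight x *
    (\sum_j partial j u x * dxi j x - xi x * (u x - u x ^+ 3))) = 0.
Proof.
move=> sol gxi xi0; have [cxi cdxi _] := gxi.
have [[C C'] eq] := sol.
pose F j x := weight x * (partial j u x * xi x).
have gF j := has_gradientM weight_gradient
  (has_gradientM (C1_gradient (C' j)) gxi).
pose G j x := weight x * (partial j u x * dxi j x + xi x * partial j (partial j u) x)
   + partial j u x * xi x * (- (a (x 0 ord0) * weight x) * (j == ord0)%:R).
have IG j : integral L (G j) = 0.
  have [cF cG dF] := gF j.
  apply: (@integral_partial_eq0 _ _ _ L0 (F j) (G j) j) => //; first exact: cG.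
  by move=> x hx; rewrite /F xi0 ?mulr0 // (le_trans hx) // rV_coord_le.
have : integral L (fun x => \sum_j G j x) = 0.
  rewrite integral_sum //; first by rewrite big1.
  by move=> j; have [_ + _] := gF j; apply.
move=> E; rewrite -[RHS]E; congr integral; apply/funext => x.
rewrite big_split /= -mulr_sumr big_split /=.
rewrite [X in _ = _ + X](bigD1 ord0) //= [X in _ = _ + (_ + X)]big1; last first.
  by move=> j /negbTE ->; rewrite !mulr0.
rewrite -mulr_sumr -(eq x) /laplacian; ring.
Qed.

End WeakForm.

(** * A global bound on the gradient *)

Lemma cubic_le1 (R : realDomainType) (r : R) : `|r| <= 1 -> `|r - r ^+ 3| <= 1.
Proof.
move=> hr; have -> : r - r ^+ 3 = r * (1 - r ^+ 2) by ring.
have r2 : r ^+ 2 <= 1 by rewrite -real_normK ?num_real // exprn_ile1.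
rewrite normrM -[leRHS]mulr1; apply: ler_pM => //.
by rewrite ler_norml; have := sqr_ge0 r; move: r2; clear; lra.
Qed.

Section GradientBound.
Variables (R : realType) (n : nat).
Local Notation V := 'rV[R]_n.+1.
Local Notation e j := (@delta_mx R 1 n.+1 0 j).
Implicit Types (F H u : V -> R) (G K : 'I_n.+1 -> V -> R) (x y v : V).

Lemma second_derivative_test (p dp : R -> R) (q delta : R) :
  (forall t, is_derive t (1 : R) p (dp t)) -> is_derive (0 : R) (1 : R) dp q ->
  0 < delta -> (forall t, `|t| <= delta -> p t <= p 0) ->
  dp 0 = 0 /\ q <= 0.
Proof.
move=> hp hdp d0 hmax.
have dp0 : dp 0 = 0.
  have [_ <-] := hp 0.
  suff /@derive_val : is_derive (0 : R) (1 : R) p 0 by [].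
  apply: (@derive1_at_max R p (- delta) delta 0); first lra.
  - by move=> t _; have [] := hp t.
  - by rewrite in_itv /= oppr_lt0 d0.
  - move=> t; rewrite in_itv /= => /andP[h1 h2]; apply: hmax.
    by rewrite ler_norml !ltW.
split=> //; rewrite leNgt; apply/negP => q0.
have C : (fun h : R => h^-1 *: (dp (h *: 1 + 0) - dp 0)) @ 0^' --> q.
  by have [+ <-] := hdp.
have /nbhs_ballP[r /= r0 hr] : \forall h \near (0 : R)^', 0 < h^-1 *: (dp (h *: 1 + 0) - dp 0).
  exact: (cvgr_gt q C).
pose s := Num.min delta (r / 2).
have s0 : 0 < s by rewrite lt_min d0 divr_gt0.
have pos t : 0 < t -> t <= s -> 0 < dp t.
  move=> t0; rewrite le_min => /andP[_ tr].
  have := hr t; rewrite /ball /= sub0r normrN gtr0_norm // => /(_ _)/wrap[].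
    by apply: le_lt_trans tr _; lra.
  move=> /(_ (lt0r_neq0 t0)).
  rewrite /GRing.scale /= mulr1 addr0 dp0 subr0 => h.
  by rewrite -(pmulr_rgt0 _ (_ : 0 < t^-1)) // invr_gt0.
have cp : continuous p.
  move=> t; apply: differentiable_continuous; apply/derivable1_diffP.
  by case: (hp t).
have [c cI E] := MVT s0 (fun t _ => hp t) (continuous_subspaceT cp).
move: cI; rewrite in_itv /= => /andP[c0 cs].
have : p s <= p 0 by apply: hmax; rewrite gtr0_norm // ge_min lexx.
rewrite leNgt => /negP; apply; rewrite -subr_gt0 E subr0 mulr_gt0 //.
by apply: pos => //; exact: ltW.
Qed.

Lemma is_derive_quadratic (c1 c2 t : R) :
  is_derive t (1 : R) (fun s => c1 * s + c2 * s ^+ 2) (c1 + 2 * c2 * t).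
Proof.
have -> : (fun s => c1 * s + c2 * s ^+ 2) = c1 \*: (id : R -> R) + c2 \*: ((id : R -> R) ^+ 2).
  by apply/funext => s.
by apply: is_derive_eq; rewrite /GRing.scale /=; ring.
Qed.

(** First and second order conditions at a maximum, in the form in which the barrier
    enters them: as a quadratic polynomial of the parameter of the line. *)
Lemma maximum_line_test F DF (ddf : R) x v (c1 c2 delta : R) :
  (forall y, is_derive y v F (DF y)) -> is_derive x v DF ddf -> 0 < delta ->
  (forall t : R, `|t| <= delta -> F (x + t *: v) + (c1 * t + c2 * t ^+ 2) <= F x) ->
  DF x + c1 = 0 /\ ddf + 2 * c2 <= 0.
Proof.
move=> dF ddF d0 hmax.
have [||||h1 h2] := @second_derivative_test
   (fun t : R => F (x + t *: v) + (c1 * t + c2 * t ^+ 2))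
   (fun t => DF (x + t *: v) + (c1 + 2 * c2 * t)) (ddf + 2 * c2) delta.
- move=> t; apply: (@is_deriveD _ _ _ (fun t : R => F (x + t *: v))).
    exact: is_derive_line.
  exact: is_derive_quadratic.
- apply: (@is_deriveD _ _ _ (fun t : R => DF (x + t *: v))).
    by apply: is_derive_line; rewrite scale0r addr0.
  have -> : (fun t : R => c1 + 2 * c2 * t) = cst c1 + (2 * c2) \*: (id : R -> R).
    by apply/funext => s.
  by apply: is_derive_eq; rewrite /GRing.scale /=; ring.
- exact: d0.
- by move=> t ht; rewrite scale0r addr0 mulr0 expr0n /= mulr0 !addr0; exact: hmax.
- by move: h1; rewrite scale0r addr0 mulr0 addr0.
Qed.

Lemma has_gradient_sum (p : nat) (Fs : 'I_p -> V -> R) (Gs : 'I_p -> 'I_n.+1 -> V -> R) :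
  (forall k, has_gradient (Fs k) (Gs k)) ->
  has_gradient (fun x => \sum_(k < p) Fs k x) (fun j x => \sum_(k < p) Gs k j x).
Proof.
elim: p Fs Gs => [|p IH] Fs Gs h.
  rewrite (_ : (fun x => _) = (fun=> 0)); last by apply/funext => x; rewrite big_ord0.
  by apply: has_gradient_eq (has_gradient_cst _ _) _ => j x; rewrite big_ord0.
rewrite (_ : (fun x => _) = (fun x =>
    \sum_(k < p) Fs (widen_ord (leqnSn p) k) x + Fs ord_max x)); last first.
  by apply/funext => x; rewrite big_ord_recr.
apply: has_gradient_eq (has_gradientD (IH _ _ (fun k => h _)) (h _)) _ => j x.
by rewrite big_ord_recr.
Qed.

Definition sqdist (x0 x : V) : R := \sum_k (x 0 k - x0 0 k) ^+ 2.

Lemma sqdist_gradient (x0 : V) :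
  has_gradient (sqdist x0) (fun j x => 2 * (x 0 j - x0 0 j)).
Proof.
have h k : has_gradient (fun x : V => (x 0 k - x0 0 k) ^+ 2)
    (fun j x => 2 * (x 0 k - x0 0 k) * (j == k)%:R).
  have hk := has_gradientD (has_gradient_coord R k) (has_gradient_cst n (- x0 0 k)).
  apply: has_gradient_eq (has_gradientM hk hk) _ => j x; ring.
apply: has_gradient_eq (has_gradient_sum h) _ => j x.
rewrite (bigD1 j) //= eqxx mulr1 big1 ?addr0 // => k kj.
by rewrite eq_sym (negbTE kj) mulr0.
Qed.

Lemma continuous_translation_flow u v : continuous u ->
  continuous (fun p : V * R => u (p.1 + p.2 *: v)).
Proof.
move=> cu p; apply: (@continuous_comp _ _ _ (fun p : V * R => p.1 + p.2 *: v) u);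
  last exact: cu.
apply: (@cvgD _ _ _ _ (nbhs_filter p) fst (fun p => p.2 *: v)); first exact: cvg_fst.
apply: (@cvgZr_tmp _ _ _ _ (nbhs_filter p)); exact: cvg_snd.
Qed.


(** Brandt's form of the maximum principle. The increment [u (x + s e_i) - u x], minus a
    concave function of [s] and minus [2 |x - x0|^2], cannot have a positive interior
    maximum in [(x, s)]: there, the first order conditions express the drift terms through
    the barrier, and the second order conditions, read along the directions in which one
    or both of the points move, contradict the difference of the equations at the two
    points. Only the second derivatives of [u] itself are used. *)
Lemma increment_le_concave (a : R -> R) (M : R) u (p : 'I_n.+1 -> V -> R)
    (q : 'I_n.+1 -> 'I_n.+1 -> V -> R) i x0 s :
  has_gradient u p -> (forall k, has_gradient (p k) (q k)) ->
  (forall x, - (\sum_k q k k x) + a (x 0 ord0) * p ord0 x = u x - u x ^+ 3) ->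
  0 <= M -> (forall t, `|a t| <= M) ->
  (forall x, `|u x| <= 1) -> 0 <= s -> s <= (M + 1)^-1 ->
  u (x0 + s *: e i) - u x0 <=
    (4 * (M + 1) + 4 * n.+1%:R) * (s - (M + 1) * s ^+ 2 / 2).
Proof.
move=> gu gp eq M0 aM u1 s0 sM.
(* B must be at least 4 (M + 1) for the barrier to exceed the oscillation of u at
   s = 1 / (M + 1), and 2 B must exceed 4 M + 2 + 4 n.+1, the sum of the contributions of
   the drift, of the reaction and of the penalization *)
set B := 4 * (M + 1) + 4 * n.+1%:R; set s1 := (M + 1)^-1 in sM *.
have M1 : 0 < M + 1 by rewrite ltr_wpDl.
have B4 : 4 * (M + 1) <= B by rewrite lerDl mulr_ge0.
have B0 : 0 < B by apply: lt_le_trans B4; rewrite mulr_gt0.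
have s10 : 0 < s1 by rewrite invr_gt0.
have Ms1 : (M + 1) * s1 = 1 by rewrite divff // gt_eqF.
pose phi (s : R) := B * (s - (M + 1) * s ^+ 2 / 2).
rewrite -/(phi s).
have phi_ge0 t : 0 <= t -> t <= s1 -> 0 <= phi t.
  move=> t0 t1; apply: mulr_ge0; first exact: ltW.
  have : (M + 1) * t <= 1 by rewrite -[leRHS]Ms1 ler_pM2l.
  nra.
have phi_s1 : 2 <= phi s1.
  have -> : phi s1 = B * s1 / 2.
    by rewrite /phi expr2 mulrA Ms1; field.
  have : 4 * (M + 1) * s1 <= B * s1 by rewrite ler_pM2r.
  rewrite -mulrA Ms1; lra.
have u2 x y : u y - u x <= 2.
  have := u1 y; have := u1 x; rewrite !ler_norml => /andP[? ?] /andP[? ?]; lra.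
(* the doubled function penalized away from x0 *)
pose H (p : V * R) := u (p.1 + p.2 *: e i) - u p.1 - phi p.2 - 2 * sqdist x0 p.1.
rewrite -subr_le0 leNgt; apply/negP => Hpos.
pose D : set (V * R) := [set x | `|x| <= `|x0| + 1 /\ `|x - x0| <= 1] `*` `[0, s1].
have [cu _ du] := gu.
have [cq _ dq] := sqdist_gradient x0.
have cH : continuous H.
  have c1 : continuous (fun p : V * R => u p.1).
    by move=> z; apply: (@continuous_comp _ _ _ fst u); [exact: cvg_fst|exact: cu].
  have c2 : continuous (fun p : V * R => sqdist x0 p.1).
    by move=> z; apply: (@continuous_comp _ _ _ fst (sqdist x0)); [exact: cvg_fst|exact: cq].
  have c3 : continuous (fun p : V * R => p.2) by move=> z; exact: cvg_snd.
  have c4 := continuous_translation_flow (v := e i) cu.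
  rewrite /H /phi; cts.
have cD : compact D.
  apply: compact_setX; last exact: segment_compact.
  apply: (subclosed_compact _ (@compact_box R n (`|x0| + 1))); last by move=> x [].
  have -> : [set x : V | `|x| <= `|x0| + 1 /\ `|x - x0| <= 1] =
     closed_ball_ Num.norm 0 (`|x0| + 1) `&` closed_ball_ Num.norm x0 1.
    by apply/seteqP; split => x; rewrite /closed_ball_ /= sub0r normrN distrC.
  by apply: closedI; exact: closed_closed_ball_.
have Dx0 : D (x0, s).
  split => /=; first by rewrite subrr normr0 lerDl.
  by rewrite in_itv /= s0.
have [[x t] xtD xtmax] := compact_EVT_max (ex_intro _ _ Dx0) cD (continuous_subspaceT cH).
rewrite inE in xtD; have [[/= xn xx0] /=] := xtD; rewrite in_itv /= => /andP[t0 ts1].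
have Ht : 0 < H (x, t).
  apply: (@lt_le_trans _ _ (H (x0, s))); last by apply: xtmax; rewrite inE.
  rewrite /H /= (_ : sqdist x0 x0 = 0); first by move: Hpos; lra.
  by rewrite /sqdist big1 // => k _; rewrite subrr expr0n.
have sq_ge y k : (y 0 k - x0 0 k) ^+ 2 <= sqdist x0 y.
  by rewrite /sqdist (bigD1 k) //= lerDl sumr_ge0 // => l _; rewrite sqr_ge0.
have sq0 y : 0 <= sqdist x0 y by apply: sumr_ge0 => k _; rewrite sqr_ge0.
(* on the boundary of the domain H is nonpositive, so the maximum is interior *)
have xlt : `|x - x0| < 1.
  rewrite lt_neqAle xx0 andbT; apply/eqP => x1.
  have [k hk] : exists k, 1 <= `|x 0 k - x0 0 k|.
    apply/not_existsP => hk.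
    have : exists k, `|(x - x0) 0 k| = 1.
      have := @mx_norm_neq0 _ _ _ (x - x0); rewrite -[mx_norm _]/(`|x - x0|) x1.
      move=> /(_ (oner_neq0 _))[[i' k] /= hk']; exists k.
      by rewrite (ord1 i') in hk'; rewrite -hk'.
    by move=> [k hk']; apply: (hk k); move: hk'; rewrite !mxE => ->.
  have : 1 <= sqdist x0 x.
    by apply: le_trans (sq_ge x k); rewrite -real_normK ?num_real // exprn_ege1.
  move: Ht; rewrite /H /=; have := u2 x (x + t *: e i); have := phi_ge0 t t0 ts1; lra.
have tgt : 0 < t.
  rewrite lt_neqAle t0 andbT; apply/eqP => t00; move: Ht.
  by rewrite /H /= -t00 scale0r addr0 /phi; have := sq0 x; rewrite expr0n /= ; lra.
have tlt : t < s1.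
  rewrite lt_neqAle ts1 andbT; apply/eqP => t00; move: Ht.
  by rewrite /H /= t00; have := sq0 x; have := u2 x (x + s1 *: e i); lra.
pose del := Num.min (1 - `|x - x0|) (Num.min t (s1 - t)).
have del0 : 0 < del by rewrite !lt_min !subr_gt0 xlt tgt tlt.
have e1 k : `|e k| <= 1.
  apply/rV_norm_le => // r; rewrite mxE /=.
  by case: (_ == _); rewrite ?normr1 ?normr0.
have ex k (r : R) : `|r| <= del -> `|x + r *: e k - x0| <= 1.
  rewrite le_min => /andP[h _]; rewrite addrAC.
  apply: le_trans (ler_normD _ _) _.
  have : `|r *: e k| <= `|r| by rewrite normrZ -[leRHS]mulr1; apply: ler_pM.
  lra.
have inD k (r r' : R) : `|r| <= del -> `|r'| <= del -> D (x + r *: e k, t + r').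
  move=> hr hr'; have h1 := ex k r hr.
  split => /=.
    split=> //; rewrite -[x + _](subrK x0) addrC.
    by apply: le_trans (ler_normD _ _) _; lra.
  move: hr'; rewrite !le_min => /andP[_ /andP[h2 h3]].
  move: h2 h3; rewrite !ler_norml in_itv /= => /andP[? ?] /andP[? ?].
  by apply/andP; split; lra.
have H_max k (r r' : R) : `|r| <= del -> `|r'| <= del ->
    H (x + r *: e k, t + r') <= H (x, t).
  by move=> hr hr'; apply: xtmax; rewrite inE; exact: inD.
have H_max0 k (r : R) : `|r| <= del -> H (x + r *: e k, t) <= H (x, t).
  by move=> hr; rewrite -{1}[t]addr0; apply: H_max => //; rewrite normr0 ltW.
have [y Ey] : exists y, y = x + t *: e i by eexists.
(* both points move along e k *)
have diag k : p k y - p k x - 4 * (x 0 k - x0 0 k) = 0 /\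
    q k k y - q k k x - 4 <= 0.
  have g1 := has_gradientD (has_gradientD (has_gradient_translate (t *: e i) gu)
     (has_gradientN gu)) (has_gradientM (has_gradient_cst n (-2)) (sqdist_gradient x0)).
  have g2 := has_gradientD (has_gradientD (has_gradient_translate (t *: e i) (gp k))
     (has_gradientN (gp k))) (has_gradientM (has_gradient_cst n (-4))
       (has_gradientD (has_gradient_coord R k) (has_gradient_cst n (- x0 0 k)))).
  have [_ _ d1] := g1; have [_ _ d2] := g2.
  have [||h1 h2] := @maximum_line_test
      (fun x => u (x + t *: e i) + - u x + -2 * sqdist x0 x)
      (fun x => p k (x + t *: e i) + - p k x + -4 * (x 0 k - x0 0 k))
      _ x (e k) 0 0 del _ (d2 k x) del0.
  - by move=> z; apply: (is_derive_eq (d1 k z)); ring.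
  - move=> r hr; have := H_max0 k r hr; rewrite /H /=; clear; lra.
  split; first by rewrite -h1 Ey; ring.
  by move: h2; rewrite eqxx /= -Ey; clear; lra.
(* only the second point moves *)
have [h1 h2] : p i y - B * (1 - (M + 1) * t) = 0 /\
    q i i y + B * (M + 1) <= 0.
  have [_ _ d2] := gp i.
  have [|h1 h2] := @maximum_line_test u (p i) _ y (e i)
    (- (B * (1 - (M + 1) * t))) (B * (M + 1) / 2) del (du i) (d2 i y) del0.
  - move=> r hr; have := H_max i 0 r; rewrite normr0 (ltW del0) => /(_ isT hr).
    rewrite /H /= !scale0r !addr0 scalerDl addrA -Ey /phi; clear; lra.
  by split=> //; move: h2; clear; lra.
(* only the first point moves *)
have h3 : - q i i x - 4 + B * (M + 1) <= 0.
  have g1 := has_gradientD (has_gradientN gu)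
    (has_gradientM (has_gradient_cst n (-2)) (sqdist_gradient x0)).
  have g2 := has_gradientD (has_gradientN (gp i)) (has_gradientM (has_gradient_cst n (-4))
       (has_gradientD (has_gradient_coord R i) (has_gradient_cst n (- x0 0 i)))).
  have [_ _ d1] := g1; have [_ _ d2] := g2.
  have [||_] := @maximum_line_test
      (fun x => - u x + -2 * sqdist x0 x) (fun x => - p i x + -4 * (x 0 i - x0 0 i))
      _ x (e i) (B * (1 - (M + 1) * t)) (B * (M + 1) / 2) del _ (d2 i x) del0.
  - by move=> z; apply: (is_derive_eq (d1 i z)); ring.
  - move=> r hr; have := H_max i r (- r) hr; rewrite normrN => /(_ hr); rewrite /H /=.
    have -> : x + r *: e i + (t - r) *: e i = y.
      by rewrite Ey -addrA -scalerDl addrCA subrr addr0.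
    rewrite -Ey /phi; clear; lra.
  by rewrite eqxx /=; clear; lra.
have lap : \sum_k q k k y - \sum_k q k k x <= 4 * n.+1%:R - 2 * B * (M + 1).
  rewrite -sumrB (bigD1 i) //= .
  have : \sum_(k < n.+1 | k != i) (q k k y - q k k x)
      <= \sum_(k < n.+1 | k != i) 4.
    by apply: ler_sum => k _; have [_] := diag k; clear; lra.
  have : \sum_(k < n.+1) (4 : R) = 4 * n.+1%:R.
    by rewrite sumr_const card_ord mulr_natr.
  rewrite (bigD1 i) //=; move: h2 h3; clear; lra.
have adv : `|a (y 0 ord0) * p ord0 y - a (x 0 ord0) * p ord0 x|
    <= M * (2 * B + 4).
  have xk k : `|x 0 k - x0 0 k| <= 1.
    by have := rV_coord_le (x - x0) k; rewrite !mxE => /le_trans; apply; exact: ltW.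
  have Mt : 0 <= 1 - (M + 1) * t /\ 1 - (M + 1) * t <= 1.
    have : (M + 1) * t <= 1 by rewrite -[leRHS]Ms1 ler_pM2l // ltW.
    have : 0 <= (M + 1) * t by rewrite mulr_ge0 // ltW.
    lra.
  have BMt : 0 <= B * (1 - (M + 1) * t) /\ B * (1 - (M + 1) * t) <= B.
    by case: Mt => ? ?; split; [rewrite mulr_ge0 // ltW|rewrite -[leRHS]mulr1 ler_pM2l].
  have [d1 _] := diag ord0; have := xk ord0; rewrite ler_norml => /andP[x1 x2].
  have [i0|i0] := eqVneq i ord0.
    apply: le_trans (ler_normB _ _) _; rewrite !normrM.
    have : `|p ord0 y| <= B.
      by rewrite -i0 ler_norml; apply/andP; split; lra.
    have : `|p ord0 x| <= B + 4.
      by rewrite i0 in h1; rewrite ler_norml; apply/andP; split; lra.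
    have := aM (y 0 ord0); have := aM (x 0 ord0).
    have := normr_ge0 (a (y 0 ord0)); have := normr_ge0 (a (x 0 ord0)).
    have := normr_ge0 (p ord0 y); have := normr_ge0 (p ord0 x).
    move=> *; apply: (@le_trans _ _ (M * B + M * (B + 4))); last lra.
    by apply: lerD; apply: ler_pM.
  have -> : y 0 ord0 = x 0 ord0.
    by rewrite Ey !mxE eqxx /= eq_sym (negbTE i0) mulr0 addr0.
  rewrite -mulrBr normrM; apply: ler_pM => //.
  by rewrite ler_norml; apply/andP; split; lra.
have := eq y; have := eq x; have := cubic_le1 (u1 x); have := cubic_le1 (u1 y).
move: adv; rewrite !ler_norml => /andP[? ?] /andP[? ?] /andP[? ?] ? ?.
have : 2 * B * (M + 1) <= M * (2 * B + 4) + 2 + 4 * n.+1%:R by lra.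
rewrite /B; have : 0 <= n.+1%:R :> R by []. lra.
Qed.

(** The equation is odd, so the bound of [increment_le_concave] for [u] and for [- u]
    gives both signs. *)
Lemma gradient_bound (a : R -> R) (M : R) u :
  classical_solution a u -> 0 <= M -> (forall t, `|a t| <= M) ->
  (forall x, `|u x| <= 1) ->
  forall i x, `|partial i u x| <= 4 * (M + 1) + 4 * n.+1%:R.
Proof.
move=> sol M0 aM u1 i x; set B := 4 * _ + _.
have B0 : 0 <= B by rewrite addr_ge0 ?mulr_ge0 // addr_ge0.
have upper w : classical_solution a w -> (forall x, `|w x| <= 1) -> partial i w x <= B.
  move=> solw w1; have [[C C'] eqw] := solw; have [_ _ dw] := C1_gradient C.
  have [h1 <-] := dw i x.
  have h2 := cvg_dnbhs_at_right h1.
  apply: (cvgr_to_le h2); near=> h.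
  have h0 : 0 < h by near: h; exact: nbhs_right_gt.
  have hM : h <= (M + 1)^-1.
    by near: h; apply: nbhs_right_le; rewrite invr_gt0 ltr_wpDl.
  rewrite /GRing.scale /= ler_pdivrMl // [_ + x]addrC.
  apply: le_trans (increment_le_concave i x (C1_gradient C)
     (fun k => C1_gradient (C' k)) eqw M0 aM w1 (ltW h0) hM) _.
  rewrite -/B [leRHS]mulrC; apply: ler_wpM2l => //.
  by rewrite gerBl divr_ge0 // mulr_ge0 ?sqr_ge0 // addr_ge0.
rewrite ler_norml; apply/andP; split; last exact: upper.
have [[C C'] eq] := sol.
have gN := has_gradientN (C1_gradient C).
have PN k : partial k (fun x => - u x) = (fun x => - partial k u x).
  exact: (gradient_partial gN).
have gN' k := has_gradientN (C1_gradient (C' k)).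
rewrite lerNl -[leLHS]/((fun x => - partial i u x) x) -PN; apply: upper.
  split; first split.
  - exact: (gradient_C1 gN).
  - by move=> k; rewrite PN; exact: (gradient_C1 (gN' k)).
  move=> z; rewrite PN.
  have -> : laplacian (fun x => - u x) z = - laplacian u z.
    rewrite /laplacian -sumrN; apply: eq_bigr => k _.
    by rewrite PN (gradient_partial (gN' k)).
  by have := eq z; rewrite exprNn -signr_odd /= expr1; lra.
by move=> z; rewrite normrN.
Unshelve. all: by end_near. Qed.

End GradientBound.

(** * The integrating factor and the growth class *)

Section Weight.
Variable R : realType.
Implicit Types (a g : R -> R) (t s h M r : R).
Local Notation mu := (@lebesgue_measure R).

Lemma derive_continuous1 (f df : R -> R) :
  (forall t, is_derive t (1 : R) f (df t)) -> continuous f.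
Proof.
move=> h t; apply: differentiable_continuous; apply/derivable1_diffP.
by case: (h t).
Qed.

Lemma smooth_continuous a : smooth a -> continuous a.
Proof.
move=> sm t; apply: differentiable_continuous; apply/derivable1_diffP.
exact: sm 0%N t.
Qed.

Lemma essentially_bounded_continuous a :
  a \in Lfun mu +oo%E -> continuous a -> exists2 M, 0 <= M & forall t, `|a t| <= M.
Proof.
move=> aL ca.
have muT : (0 < mu setT)%E.
  apply: (@lt_le_trans _ _ (mu `]0%R, 1%R])); last first.
    by apply: le_measure; rewrite ?inE.
  by rewrite lebesgue_measure_itv /= lte_fin ltr01 oppr0 adde0 lte_fin.
move: aL; rewrite !inE => /andP[_]; rewrite inE /= /finite_norm unlock /Lnorm muT => fin.
move: fin; rewrite (_ : abse \o _ = EFin \o (fun s => `|a s|)) //.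
move=> /ess_sup_inf.ess_supr_bounded[M fM].
exists `|M| => // t; rewrite leNgt; apply/negP => Mt.
have [N [mN N0 sub]] := fM.
have ct : continuous (fun s => `|a s|).
  by move=> s; apply: (continuous_comp (ca s)); exact: norm_continuous.
have /nbhs_ballP[d /= d0 hd] : \forall s \near t, `|M| < `|a s|.
  exact: (cvgr_gt _ (ct t)).
have : (mu (ball t d) <= mu N)%E.
  apply: le_measure; rewrite ?inE //; first by rewrite ball_itv; exact: measurable_itv.
  move=> s /hd hs; apply: sub => /= hM.
  by move: hs; apply/negP; rewrite -leNgt (le_trans hM) // ler_norm.
rewrite N0 (lebesgue_measure_ball _ (ltW d0)).
by rewrite lee_fin leNgt mulrn_wgt0.
Qed.

Lemma integrable_segment f s t : continuous f -> mu.-integrable `[s, t] (EFin \o f).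
Proof.
move=> cf; apply: continuous_compact_integrable; first exact: segment_compact.
exact: continuous_subspaceT.
Qed.

Lemma Rintegral_segmentB f b s t : continuous f -> b <= s -> s <= t ->
  \int[mu]_(x in `[b, t]) f x - \int[mu]_(x in `[b, s]) f x =
  \int[mu]_(x in `[s, t]) f x.
Proof.
move=> cf bs st; rewrite Rintegral_itvB ?bnd_simp //; last exact: integrable_segment.
rewrite Rintegral_itv_obnd_cbnd //.
apply: integrableS (integrable_segment s t cf) => //.
by apply: subset_itvr; rewrite bnd_simp.
Qed.

Lemma oriented_integral_derive a t : continuous a ->
  is_derive t (1 : R) (oriented_integral a 0) (a t).
Proof.
move=> ca.
(* a base point below both 0 and t removes the case distinction on the sign of t *)
pose b := - (`|t| + 1).
have b0 : b <= 0 by rewrite oppr_le0 addr_ge0.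
have bt : b < t.
  by rewrite /b ltrNl; have := ler_norm (- t); rewrite normrN; lra.
pose P s := \int[mu]_(x in `[b, s]) a x.
have key s : b <= s -> P s - P 0 = oriented_integral a 0 s.
  rewrite /oriented_integral /P => bs; case: (leP 0 s) => s0.
    exact: Rintegral_segmentB.
  by rewrite -opprB Rintegral_segmentB // ltW.
apply: (@near_eq_is_derive _ _ _ (fun s => P s - P 0)).
  near=> s; apply: key; near: s.
  by apply: filterS (lt_nbhsr bt) => s /ltW.
have [dP <-] : is_derive t (1 : R) P (a t).
  have [] := @continuous_FTC1_closed R a b t (t + 1) _ _ bt (ca t).
  - by rewrite ltrDl.
  - exact: integrable_segment.
  by move=> d1 d2; exact: DeriveDef d1 (etrans (esym (derive1E _ _)) d2).
rewrite -[X in is_derive _ _ _ X]subr0.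
exact: (@is_deriveB _ _ _ P (cst (P 0))).
Unshelve. all: by end_near. Qed.

Definition drift_weight a t : R := expR (- oriented_integral a 0 t).

Lemma drift_weight_derive a t : continuous a ->
  is_derive t (1 : R) (drift_weight a) (- (a t * drift_weight a t)).
Proof.
move=> ca; have dA := oriented_integral_derive t ca.
have dN : is_derive t (1 : R) (fun s => - oriented_integral a 0 s) (- a t).
  exact: (@is_deriveN _ _ _ (oriented_integral a 0)).
have := @is_derive1_comp _ expR _ t _ _ (is_derive_expR _) dN.
by move=> /is_derive_eq; apply; rewrite /drift_weight mulrN mulrC.
Qed.

Lemma drift_weight_gt0 a t : 0 < drift_weight a t.
Proof. exact: expR_gt0. Qed.

(** The logarithmic derivative of the weight is [- a], hence bounded. *)
Lemma drift_weight_harnack a M t h : continuous a -> (forall t, `|a t| <= M) ->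
  0 <= h -> h <= 1 -> drift_weight a t <= expR M * drift_weight a (t + h).
Proof.
move=> ca aM h0 h1; rewrite /drift_weight -expRD ler_expR.
have cA : continuous (oriented_integral a 0).
  by apply: derive_continuous1 => s; exact: oriented_integral_derive.
have tth : t <= t + h by rewrite lerDl.
have [c _ E] := MVT_segment tth (fun s _ => oriented_integral_derive s ca)
  (continuous_subspaceT cA).
have := aM c; rewrite ler_norml => /andP[_ ac].
have M0 : 0 <= M by apply: le_trans (aM c).
have : a c * h <= M * 1.
  apply: (@le_trans _ _ (M * h)); first by rewrite ler_wpM2r.
  by rewrite ler_wpM2l.
move: E; rewrite [t + h]addrC addrK; lra.
Qed.

(** The integral function of the weight, multiplied by [exp M] so that its increments
    dominate the values at the left ends of intervals of length at most [1], and frozen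
    outside of [[-r, r]]. *)
Lemma drift_weight_primitive a M r K : continuous a -> (forall t, `|a t| <= M) ->
  1 <= r ->
  (\int[mu]_(x in `[(- r)%R, r]) (drift_weight a x)%:E <= K%:E)%E ->
  exists G : R -> R, [/\ {homo G : s t / s <= t},
    forall t h, `|t| <= r - 1 -> 0 < h -> h <= 1 ->
      h * drift_weight a t <= G (t + h) - G t
    & forall L, G L - G (- L) <= expR M * K].
Proof.
move=> ca aM r1 hK.
have cw : continuous (drift_weight a).
  by apply: derive_continuous1 => s; exact: drift_weight_derive.
pose c t := Num.min (Num.max t (- r)) r.
pose P t := \int[mu]_(x in `[- r, t]) drift_weight a x.
have P0 t : 0 <= P t by apply: Rintegral_ge0 => x _; exact: expR_ge0.
have PB s t : - r <= s -> s <= t -> P t - P s = \int[mu]_(x in `[s, t]) drift_weight a x.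
  by move=> *; exact: Rintegral_segmentB.
have Pmono s t : - r <= s -> s <= t -> P s <= P t.
  move=> rs st; rewrite -subr_ge0 PB //.
  by apply: Rintegral_ge0 => x _; exact: expR_ge0.
have cge t : - r <= c t by rewrite le_min le_max lexx orbT /=; lra.
have cle t : c t <= r by rewrite ge_min lexx orbT.
have eM : 0 <= expR M by exact: expR_ge0.
exists (fun t => expR M * P (c t)); split.
- move=> s t st; apply: ler_wpM2l => //; apply: Pmono => //.
  exact: clamp_mono.
- move=> t h; rewrite ler_norml => /andP[t1 t2] h0 h1.
  rewrite /c !clamp_id; [|lra..].
  rewrite -mulrBr PB; [|lra..].
  have lower : h * (expR (- M) * drift_weight a t) <=
      \int[mu]_(x in `[t, t + h]) drift_weight a x.
    have mus : fine (mu `[t, t + h]) = h.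
      rewrite lebesgue_measure_itv /= lte_fin ltrDl h0 /=; lra.
    rewrite -{1}mus mulrC -Rintegral_cst //; last first.
    apply: le_Rintegral => //.
    + apply: integrable_segment; exact: cst_continuous.
    + exact: integrable_segment.
    move=> x; rewrite /= in_itv /= => /andP[x1 x2].
    rewrite expRN ler_pdivrMl ?expR_gt0 //.
    have := @drift_weight_harnack a M t (x - t) ca aM.
    by rewrite [t + _]addrC subrK; apply; lra.
  have := ler_wpM2l eM lower; apply: le_trans.
  by rewrite expRN mulrCA mulVKf ?gt_eqF ?expR_gt0.
- move=> L; rewrite -mulrBr; apply: ler_wpM2l => //.
  apply: (@le_trans _ _ (P r)).
    apply: (@le_trans _ _ (P (c L))); last exact: Pmono.
    by rewrite gerBl.
  rewrite /P /Rintegral -lee_fin; apply: le_trans hK.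
  rewrite le_eqVlt fineK ?eqxx //.
  exact: integrable_fin_num (integrable_segment _ _ cw).
Qed.

(** A monotone modification of the integrand outside of the domain gives measurability. *)
Lemma measurable_classG g : classG g ->
  measurable_fun (`[1%R, +oo[%classic : set R) (fun r : R => (r * g r)^-1).
Proof.
move=> [g0 gm _].
pose H r := - (Num.max r 1 * g (Num.max r 1))^-1.
have mH : measurable_fun (`[1%R, +oo[%classic : set R) H.
  apply: nondecreasing_measurable => // x y xy; rewrite /H lerN2.
  have m0 z : 0 < Num.max z 1 :> R by rewrite lt_max ltr01 orbT.
  have mxy : Num.max x 1 <= Num.max y 1 by rewrite ge_max !le_max xy lexx orbT.
  rewrite lef_pV2 ?posrE ?mulr_gt0 ?g0 //.
  by apply: ler_pM; [exact: ltW|apply/ltW/g0|exact: mxy|exact: gm].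
apply: (eq_measurable_fun (fun r => - H r)); last exact: measurableT_comp.
move=> x; rewrite inE /= in_itv /= andbT => x1.
by rewrite /H opprK max_l.
Qed.

Lemma classG_dyadic_block g j : classG g ->
  (\int[mu]_(r in `[(2 ^+ j)%R, (2 ^+ j.+1)%R[) ((r * g r)^-1)%:E <= ((g (2 ^+ j))^-1)%R%:E)%E.
Proof.
move=> Gg; have [g0 gm _] := Gg.
have p0 : 0 < 2 ^+ j :> R by rewrite exprn_gt0.
apply: (@le_trans _ _ (\int[mu]_(r in `[(2 ^+ j)%R, (2 ^+ j.+1)%R[)
    ((2 ^+ j * g (2 ^+ j))^-1)%R%:E)%E).
  apply: ge0_le_integral => //.
  - move=> x; rewrite /= in_itv /= => /andP[x1 _].
    have x0 := lt_le_trans p0 x1.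
    by rewrite lee_fin invr_ge0 mulr_ge0 ?ltW ?g0.
  - apply/measurable_EFinP.
    apply: measurable_funS (measurable_classG Gg) => // x; rewrite /= !in_itv /= andbT.
    by move=> /andP[+ _]; apply: le_trans; rewrite exprn_ege1 // ler1n.
  - move=> x; rewrite /= in_itv /= => /andP[x1 _].
    have x0 := lt_le_trans p0 x1.
    rewrite lee_fin lef_pV2 ?posrE ?mulr_gt0 ?g0 //.
    by apply: ler_pM; [exact: ltW|apply/ltW/g0|exact: x1|exact: gm].
have muE : mu `[(2 ^+ j)%R, (2 ^+ j.+1)%R[%classic = (2 ^+ j)%:E.
  rewrite lebesgue_measure_itv /= lte_fin.
  have -> : 2 ^+ j < 2 ^+ j.+1 :> R by rewrite exprS; lra.
  by rewrite -EFinD exprS; congr (_%:E); ring.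
rewrite integral_cst // [X in (_ * X)%E]muE -EFinM lee_fin.
by rewrite invfM mulrAC mulVf ?mul1r // gt_eqF.
Qed.

(** On the dyadic block from [2^j] to [2^(j+1)] the integrand is at most its value at the
    left end, so the divergent integral is dominated by the sum. *)
Lemma classG_sum_unbounded g : classG g -> forall (j0 : nat) (B : R),
  exists J : nat, B < \sum_(j0 <= j < J) (g (2 ^+ j))^-1.
Proof.
move=> Gg j0 B; have [g0 gm ginf] := Gg; apply: contrapT => /forallNP H.
pose C := \sum_(0 <= j < j0) (g (2 ^+ j))^-1 + `|B|.
have gp j : 0 <= (g (2 ^+ j))^-1 by rewrite invr_ge0 ltW // g0 // exprn_gt0.
have SC J : \sum_(0 <= j < J) (g (2 ^+ j))^-1 <= C.
  have [Jj|jJ] := leqP J j0.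
    rewrite /C (big_cat_nat _ Jj) //= -addrA lerDl addr_ge0 //.
    exact: sumr_ge0.
  rewrite (big_cat_nat (n := j0)) ?(ltnW jJ) //= lerD2l.
  have := H J; move=> /negP; rewrite -leNgt => /le_trans; apply.
  exact: ler_norm.
pose F (i : nat) : set (measurableTypeR R) := `[1%R, (2 ^+ i)%R[%classic.
have mF i : measurable (F i) by exact: measurable_itv.
have FU : \bigcup_i F i = `[1%R, +oo[%classic.
  apply/seteqP; split => x.
    by move=> [i _]; rewrite /F /= !in_itv /= andbT => /andP[].
  rewrite /= in_itv /= andbT => x1.
  have [i hi] : exists i : nat, x < 2 ^+ i.
    exists (Num.truncn x).+1; apply: lt_le_trans (truncnS_gt x) _.
    by rewrite -natrX ler_nat ltnW // ltn_expl.
  by exists i => //; rewrite /F /= in_itv /= x1.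
have f0 x : 1 <= x -> (0 <= ((x * g x)^-1)%:E)%E.
  move=> x1; have x0 : 0 < x := lt_le_trans ltr01 x1.
  by rewrite lee_fin invr_ge0 mulr_ge0 ?ltW ?g0.
have mf (D : set (measurableTypeR R)) : measurable D -> D `<=` `[1%R, +oo[ ->
    measurable_fun D (fun r : R => (r * g r)^-1).
  by move=> mD DS; apply: measurable_funS (measurable_classG Gg).
have bound i : (\int[mu]_(r in F i) ((r * g r)^-1)%:E <=
    (\sum_(0 <= j < i) (g (2 ^+ j))^-1)%R%:E)%E.
  elim: i => [|i IH].
    rewrite big_nil /F expr0 set_itv_ge ?integral_set0 //.
    by rewrite bnd_simp ltxx.
  have p1 : 1 <= 2 ^+ i :> R by rewrite exprn_ege1 // ler1n.
  have p2 : 2 ^+ i <= 2 ^+ i.+1 :> R by rewrite exprS; lra.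
  have -> : F i.+1 = F i `|` `[2 ^+ i, 2 ^+ i.+1[.
    by rewrite /F -itv_bndbnd_setU // bnd_simp.
  rewrite ge0_integral_setU //.
  - rewrite big_nat_recr //= EFinD; apply: leeD => //.
    exact: classG_dyadic_block.
  - apply/measurable_EFinP; apply: mf; first by apply: measurableU; [exact: mF|exact: measurable_itv].
    move=> x [|]; rewrite /F /= !in_itv /= andbT => /andP[h _] //.
    exact: le_trans h.
  - move=> x [|]; rewrite /F /= in_itv /= => /andP[h _]; apply: f0 => //.
    exact: le_trans h.
  - apply/disj_setPS => x [/=]; rewrite /F /= !in_itv /= => /andP[_ h1] /andP[h2 _].
    by have := lt_le_trans h1 h2; rewrite ltxx.
have cv : (\int[mu]_(x in F i) ((x * g x)^-1)%:E @[i --> \oo] -->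
    \int[mu]_(x in \bigcup_i F i) ((x * g x)^-1)%:E)%E.
  apply: ge0_nondecreasing_set_cvg_integral.
  - move=> i j ij; apply/subsetPset => x; rewrite /F /= !in_itv /= => /andP[-> h].
    by apply: lt_le_trans h _; rewrite ler_eXn2l // ltr1n.
  - exact: mF.
  - move=> i; apply/measurable_EFinP; apply: mf; first exact: mF.
    by move=> x; rewrite /F /= !in_itv /= andbT => /andP[].
  - by move=> i x; rewrite /F /= in_itv /= => /andP[h _]; exact: f0.
have : (\int[mu]_(x in \bigcup_i F i) ((x * g x)^-1)%:E <= C%:E)%E.
  rewrite -(cvg_lim _ cv) //; apply: lime_le.
    by apply/cvg_ex; eexists; exact: cv.
  by apply: nearW => i; apply: le_trans (bound i) _; rewrite lee_fin.
by rewrite FU ginf leNgt ltry.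
Qed.

End Weight.

(** * Cutoff functions *)

Section Cutoff.
Variables (R : realType) (n : nat).
Local Notation V := 'rV[R]_n.+1.
Implicit Types (x : V) (r s t : R).

Definition pos_part t : R := Num.max 0 t.

Lemma pos_part_cases t : (t <= 0 /\ pos_part t = 0) \/ (0 <= t /\ pos_part t = t).
Proof.
by rewrite /pos_part; have [t0|t0] := leP t 0; [left|right; rewrite ltW].
Qed.

Lemma pos_part_ge0 t : 0 <= pos_part t.
Proof. by rewrite le_max lexx. Qed.

Lemma continuous_pos_part : continuous pos_part.
Proof.
move=> t; apply: continuous_max; [exact: cst_continuous|exact: cvg_id].
Qed.

Lemma is_derive_pos_part_sqr t :
  is_derive t (1 : R) (fun s => pos_part s ^+ 2) (2 * pos_part t).
Proof.
apply: is_derive_of_estimate => eps eps0; exists eps => // h hh.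
apply: (@le_trans _ _ (`|h| * `|h|)); last by apply: ler_pM.
rewrite -expr2 real_normK ?num_real // ler_norml.
case: (pos_part_cases (t + h)) => -[h1 ->]; case: (pos_part_cases t) => -[h2 ->];
  by apply/andP; split; nra.
Qed.

(** Since [pos_part s ^+ 2] is of class C^1, so is [bump], which equals [1] for [s <= 1] and
    [0] for [4 <= s]; it is applied to the squared Euclidean norm. *)
Definition bump_base s : R := 1 - pos_part ((4 - s) / 3) ^+ 2.
Definition bump s : R := 1 - pos_part (bump_base s) ^+ 2.
Definition dbump s : R := - (4 / 3) * pos_part (bump_base s) * pos_part ((4 - s) / 3).

Lemma is_derive_bump s : is_derive s (1 : R) bump (dbump s).
Proof.
have d1 : is_derive s (1 : R) (fun s => (4 - s) / 3) (- (1 / 3)).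
  have -> : (fun s => (4 - s) / 3) = cst (4 / 3) + (- (1 / 3)) \*: (id : R -> R).
    apply/funext => t; change ((4 - t) / 3 = 4 / 3 + - (1 / 3) * t); ring.
  have d0 : is_derive s (1 : R) (cst (4 / 3) + (- (1 / 3)) \*: (id : R -> R))
      (0 + - (1 / 3) *: (1 : R)) by exact: is_deriveD.
  by rewrite add0r /GRing.scale /= mulr1 in d0.
have d2 : is_derive s (1 : R) bump_base (2 / 3 * pos_part ((4 - s) / 3)).
  have := @is_derive1_comp _ (fun s => pos_part s ^+ 2) (fun s => (4 - s) / 3) s _ _
    (is_derive_pos_part_sqr _) d1.
  move=> /(@is_deriveB R R R (cst (1 : R)) _ _ _ _ _ (is_derive_cst _ _ _)).
  by move=> /is_derive_eq; apply; field.
have := @is_derive1_comp _ (fun s => pos_part s ^+ 2) bump_base s _ _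
    (is_derive_pos_part_sqr _) d2.
move=> /(@is_deriveB R R R (cst (1 : R)) _ _ _ _ _ (is_derive_cst _ _ _)).
by move=> /is_derive_eq; apply; rewrite /dbump; field.
Qed.

Lemma continuous_dbump : continuous dbump.
Proof.
have c1 : continuous (fun s : R => pos_part ((4 - s) / 3)).
  apply: continuous_compf; first exact: continuous_pos_part.
  have ci : continuous (fun s : R => s) by move=> s; exact: cvg_id.
  by cts.
have c2 : continuous (fun s => pos_part (bump_base s)).
  apply: continuous_compf; first exact: continuous_pos_part.
  rewrite /bump_base; cts.
rewrite /dbump; cts.
Qed.

Lemma bump_in01 s : 0 <= bump s <= 1.
Proof.
rewrite /bump; have := sqr_ge0 (pos_part (bump_base s)).
have : pos_part (bump_base s) ^+ 2 <= 1.
  rewrite exprn_ile1 ?pos_part_ge0 //; rewrite ge_max ler01 /= /bump_base.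
  by rewrite gerBl sqr_ge0.
by move=> *; apply/andP; split; lra.
Qed.

Lemma bump_base_le0 s : s <= 1 -> pos_part (bump_base s) = 0.
Proof.
move=> s1; rewrite /bump_base.
case: (pos_part_cases ((4 - s) / 3)) => -[h1 ->]; first lra.
by case: (pos_part_cases (1 - ((4 - s) / 3) ^+ 2)) => -[h2 ->] //; nra.
Qed.

Lemma bump_inner s : s <= 1 -> bump s = 1 /\ dbump s = 0.
Proof.
by move=> s1; rewrite /bump /dbump bump_base_le0 // expr0n /= subr0 mulr0 mul0r.
Qed.

Lemma bump_outer s : 4 <= s -> bump s = 0 /\ dbump s = 0.
Proof.
move=> s1; rewrite /bump /dbump /bump_base.
have -> : pos_part ((4 - s) / 3) = 0.
  by case: (pos_part_cases ((4 - s) / 3)) => -[h1 ->] //; lra.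
rewrite expr0n /= subr0 mulr0; split=> //.
by case: (pos_part_cases 1) => -[h1 ->]; [lra|rewrite expr1n subrr].
Qed.

Lemma dbump_le s : `|dbump s| <= 4 / 3.
Proof.
have [s1|s1] := leP s 1; first by have [_ ->] := bump_inner s1; rewrite normr0.
rewrite /dbump !normrM normrN !ger0_norm ?pos_part_ge0 //.
rewrite -mulrA -[leRHS]mulr1; apply: ler_wpM2l => //.
rewrite -[leRHS]mulr1; apply: ler_pM; rewrite ?pos_part_ge0 //.
  by rewrite /pos_part ge_max ler01 /= /bump_base gerBl sqr_ge0.
by rewrite /pos_part ge_max ler01 /=; lra.
Qed.

Definition cutoff r x : R := bump (sqdist 0 x / r ^+ 2).
Definition dcutoff r (j : 'I_n.+1) x : R :=
  dbump (sqdist 0 x / r ^+ 2) * (2 * x 0 j / r ^+ 2).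

Lemma cutoff_gradient r : has_gradient (cutoff r) (dcutoff r).
Proof.
have g1 := has_gradientM (sqdist_gradient (0 : V)) (has_gradient_cst n (r ^+ 2)^-1).
have := has_gradient_comp is_derive_bump continuous_dbump g1.
move=> /has_gradient_eq; apply => j x; rewrite /dcutoff !mxE; congr (_ * _); ring.
Qed.

Lemma cutoff_in01 r x : 0 <= cutoff r x <= 1.
Proof. exact: bump_in01. Qed.

Lemma cutoff_inner r x : 0 < r -> sqdist 0 x <= r ^+ 2 ->
  cutoff r x = 1 /\ forall j, dcutoff r j x = 0.
Proof.
move=> r0 h; have [h1 h2] : bump (sqdist 0 x / r ^+ 2) = 1 /\ dbump (sqdist 0 x / r ^+ 2) = 0.
  by apply: bump_inner; rewrite ler_pdivrMr ?mul1r // exprn_gt0.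
by split=> // j; rewrite /dcutoff h2 mul0r.
Qed.

Lemma cutoff_outer r x : 0 < r -> (2 * r) ^+ 2 <= sqdist 0 x ->
  cutoff r x = 0 /\ forall j, dcutoff r j x = 0.
Proof.
move=> r0 h; have [h1 h2] : bump (sqdist 0 x / r ^+ 2) = 0 /\ dbump (sqdist 0 x / r ^+ 2) = 0.
  apply: bump_outer; rewrite ler_pdivlMr ?exprn_gt0 //.
  by apply: le_trans h; rewrite exprMn; lra.
by split=> // j; rewrite /dcutoff h2 mul0r.
Qed.

Lemma sqdist0_ge_coord x j : x 0 j ^+ 2 <= sqdist 0 x.
Proof.
rewrite /sqdist (bigD1 j) //= !mxE subr0 lerDl sumr_ge0 // => k _.
exact: sqr_ge0.
Qed.

Lemma sqdist0_ge_norm x r : 0 <= r -> r <= `|x| -> r ^+ 2 <= sqdist 0 x.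
Proof.
move=> r0 rx; have [x0|x0] := eqVneq `|x| 0.
  have -> : r = 0 by apply/le_anti; rewrite r0 -x0 rx.
  by rewrite expr0n /=; apply: sumr_ge0 => k _; exact: sqr_ge0.
have [[i j] /= E] := mx_norm_neq0 x0.
apply: le_trans (sqdist0_ge_coord x j).
rewrite -(ord1 i) -[leRHS]real_normK ?num_real // -E.
rewrite -[mx_norm x]/(`|x|) ler_pXn2r ?nnegrE //.
Qed.

Lemma cutoff_support r x : 0 < r -> 2 * r <= `|x| -> cutoff r x = 0.
Proof.
move=> r0 h; have [] // := @cutoff_outer r x r0 _.
by apply: sqdist0_ge_norm => //; rewrite mulr_ge0 // ltW.
Qed.

Lemma dcutoff_le r j x : 0 < r -> `|dcutoff r j x| <= 6 / r * cutoff (2 * r) x.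
Proof.
move=> r0.
have [h|h] := leP ((2 * r) ^+ 2) (sqdist 0 x).
  have [_ ->] := cutoff_outer r0 h; rewrite normr0.
  have /andP[c0 _] := cutoff_in01 (2 * r) x.
  by rewrite mulr_ge0 // divr_ge0 // ltW.
have r20 : 0 < 2 * r by rewrite mulr_gt0.
have [-> _] := cutoff_inner r20 (ltW h).
have xj : `|x 0 j| <= 2 * r.
  rewrite -(ler_pXn2r (n := 2)) ?nnegrE ?(ltW r20) //.
  rewrite real_normK ?num_real //; apply: le_trans (ltW h).
  exact: sqdist0_ge_coord.
rewrite mulr1 /dcutoff normrM.
apply: (@le_trans _ _ (4 / 3 * (4 * r / r ^+ 2))).
  apply: ler_pM => //; first exact: dbump_le.
  rewrite normrM normfV [X in _ / X]ger0_norm ?sqr_ge0 //.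
  rewrite ler_wpM2r ?invr_ge0 ?sqr_ge0 // normrM ger0_norm //.
  by move: xj; lra.
have -> : 4 / 3 * (4 * r / r ^+ 2) = 16 / 3 / r by field; exact: lt0r_neq0.
by rewrite ler_pM2r ?invr_gt0 //; lra.
Qed.

Lemma cutoff_le_double r x : 0 < r -> cutoff r x <= cutoff (2 * r) x.
Proof.
move=> r0; have /andP[c0 c1] := cutoff_in01 r x.
have r20 : 0 < 2 * r by rewrite mulr_gt0.
have [h|h] := leP ((2 * r) ^+ 2) (sqdist 0 x).
  have [-> _] := cutoff_outer r0 h.
  by have /andP[] := cutoff_in01 (2 * r) x.
by have [-> _] := cutoff_inner r20 (ltW h).
Qed.

(** This is what confines the cross term of Caccioppoli's inequality to the energy gained
    between two consecutive scales. *)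
Lemma cutoff_nested r j x : 0 < r -> dcutoff (2 * r) j x <> 0 -> cutoff r x = 0.
Proof.
move=> r0 h; have [h1|h1] := leP ((2 * r) ^+ 2) (sqdist 0 x).
  by have [] := cutoff_outer r0 h1.
have r20 : 0 < 2 * r by rewrite mulr_gt0.
by have [_ h2] := cutoff_inner r20 (ltW h1).
Qed.

End Cutoff.

(** * Linearization and sliding *)

(* From here on partial derivatives are only manipulated through their properties. *)
Local Opaque partial.

(* Abstracting partial derivatives and finite sums keeps the algebraic tactics from
   comparing them up to conversion. *)
Ltac gen_atoms :=
  repeat match goal with
  | |- context [bigop.body ?z ?r ?F] => generalize (bigop.body z r F); intro
  | |- context [partial ?i ?u ?x] => generalize (partial i u x); intro
  end.

Section Energy.
Variables (R : realType) (n : nat) (L : R).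
Hypothesis L0 : 0 < L.
Local Notation V := 'rV[R]_n.+1.
Local Notation e j := (@delta_mx R 1 n.+1 0 j).
Variables (a omega : R -> R).
Hypothesis a_cont : continuous a.
Hypothesis omega_gt0 : forall t, 0 < omega t.
Hypothesis omega_derive : forall t, is_derive t (1 : R) omega (- (a t * omega t)).
Implicit Types (x y v : V).
Local Notation w := (@weight R n omega).
Local Notation I := (integral L).

Lemma continuous_weight : continuous w.
Proof. by have [] := weight_gradient n a_cont omega_derive. Qed.

Lemma weight_gt0 x : 0 < w x.
Proof. exact: omega_gt0. Qed.

Lemma is_derive_integral_sum (p : nat) (W F G : 'I_p -> V -> R) v (t : R) :
  (forall k, continuous (W k)) -> (forall k, continuous (F k)) ->
  (forall k, continuous (G k)) -> (forall k x, is_derive x v (F k) (G k x)) ->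
  is_derive t (1 : R) (fun s => I (fun x => \sum_k W k x * F k (x + s *: v)))
    (I (fun x => \sum_k W k x * G k (x + t *: v))).
Proof.
move=> cW cF cG dF.
have -> : (fun s => I (fun x => \sum_k W k x * F k (x + s *: v))) =
    \sum_(k < p) (fun s => I (fun x => W k x * F k (x + s *: v))).
  apply/funext => s; rewrite fct_sumE (integral_sum L0) // => k; cts.
rewrite (integral_sum L0); last by move=> k; cts.
by apply: is_derive_sum => k; exact: is_derive_integral.
Qed.

Variable u : V -> R.
Hypothesis u_sol : classical_solution a u.

Let gu := C1_gradient (solution_C1 u_sol).
Let gpu i := C1_gradient (solution_partial_C1 i u_sol).

Lemma continuous_u : continuous u. Proof. by have [] := gu. Qed.
Lemma continuous_pu i : continuous (partial i u). Proof. by have [] := gpu i. Qed.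
Lemma continuous_ppu i j : continuous (partial j (partial i u)).
Proof. by have [_ + _] := gpu i; apply. Qed.

Lemma translate_coord0 l (t : R) : l != ord0 -> (t *: e l) 0 ord0 = 0.
Proof. by move=> l0; rewrite !mxE eq_sym (negbTE l0) mulr0. Qed.

(** The equation is invariant under translations along [e i] for [i != ord0], so
    differentiating its weak form along such translations linearizes it. *)
Lemma linearized_weak i xi dxi : i != ord0 -> has_gradient xi dxi ->
  (forall x, L <= `|x| -> xi x = 0) ->
  I (fun x => w x * (\sum_j partial j (partial i u) x * dxi j x
     - xi x * ((1 - 3 * u x ^+ 2) * partial i u x))) = 0.
Proof.
move=> i0 gxi xi0; have [cxi cdxi _] := gxi.
have cw := continuous_weight.
have cu := continuous_u; have cpu := continuous_pu; have cppu := continuous_ppu.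
(* the integrand of the weak form as a sum of n.+2 products of a fixed function and a
   translated one, the last index carrying the reaction term *)
pose W (k : 'I_n.+2) x := if unlift ord_max k is Some j then w x * dxi j x else - (w x * xi x).
pose F (k : 'I_n.+2) x := if unlift ord_max k is Some j then partial j u x else u x - u x ^+ 3.
pose G (k : 'I_n.+2) x := if unlift ord_max k is Some j then partial i (partial j u) x
   else (1 - 3 * u x ^+ 2) * partial i u x.
have dF k x : is_derive x (e i) (F k) (G k x).
  rewrite /F /G; case: (unlift _ k) => [j|].
    by have [_ _] := gpu j; apply.
  have gf := has_gradientD gu (has_gradientN (has_gradientM gu (has_gradientM gu gu))).
  have [_ _ d] := gf; have := d i x.
  have -> : (fun x => u x + - (u x * (u x * u x))) = (fun x => u x - u x ^+ 3).
    by apply/funext => y; ring.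
  by move=> /is_derive_eq; apply; ring.
have cW k : continuous (W k).
  by rewrite /W; case: (unlift _ k) => [j|]; clear dF; cts.
have cF k : continuous (F k).
  by rewrite /F; case: (unlift _ k) => [j|]; clear dF cW; cts.
have cG k : continuous (G k).
  rewrite /G; case: (unlift _ k) => [j|]; clear dF cW cF.
    cts.
  cts.
pose P s := I (fun x => \sum_k W k x * F k (x + s *: e i)).
have dP : is_derive (0 : R) (1 : R) P (I (fun x => \sum_k W k x * G k (x + 0 *: e i))).
  exact: is_derive_integral_sum.
have sumE (H : 'I_n.+2 -> R) : \sum_k H k = \sum_(j < n.+1) H (lift ord_max j) + H ord_max.
  rewrite big_ord_recr /=; congr (_ + _); apply: eq_bigr => j _; congr H.
  by apply: ord_inj; rewrite lift_max.
have P0 : P = cst 0.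
  apply/funext => s; rewrite /P /=.
  have sol := solution_translate (translate_coord0 s i0) u_sol.
  rewrite -[RHS](solution_weak L0 a_cont omega_derive sol gxi xi0); congr integral.
  apply/funext => x; rewrite sumE /W /F unlift_none.
  rewrite [RHS]mulrBr mulr_sumr; congr (_ + _); last by ring.
  apply: eq_bigr => j _; rewrite liftK.
  by rewrite (partial_translate _ _ (solution_C1 u_sol)); ring.
move: dP; rewrite P0 => -[_]; rewrite derive_cst => E; rewrite [RHS]E; congr integral.
apply/funext => x; rewrite sumE /W /G unlift_none scale0r addr0.
rewrite [LHS]mulrBr mulr_sumr; congr (_ + _); last by ring.
apply: eq_bigr => j _; rewrite liftK (solution_mixed i j x u_sol).
by ring.
Qed.

Variables (B : R) (l : 'I_n.+1).
Hypothesis l0 : l != ord0.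
Hypothesis u_abs : forall x, `|u x| <= 1.
Hypothesis grad_abs : forall j x, `|partial j u x| <= B.
Hypothesis u_mono : forall x, 0 < partial l u x.
Hypothesis u_lim : forall x (s : R), 0 < s -> exists T : R, 1 - u (x + T *: e l) <= s.

Lemma monotone_line x (t t' : R) : t <= t' -> u (x + t *: e l) <= u (x + t' *: e l).
Proof.
move=> tt'; have [_ _ du] := gu.
have [s _] := @mean_value_line _ _ u (partial l u) (x + t *: e l) (e l) (t' - t)
  (fun s => du l _).
rewrite -addrA -scalerDl [t + _]addrC subrK => E.
by rewrite -subr_ge0 E mulr_ge0 ?subr_ge0 // ltW.
Qed.

(** Dini's theorem along the direction of monotonicity. *)
Lemma uniform_limit (s : R) : 0 < s ->
  exists2 T, 0 <= T & forall x, `|x| <= L -> 1 - u (x + T *: e l) <= s.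
Proof.
move=> s0.
have /compact_near_coveringP cov := @compact_box R n L.
have H : \forall T \near +oo, [set x : V | `|x| <= L] `<=`
    [set x | 1 - u (x + T *: e l) <= s].
  apply: cov => x _.
  have [T hT] := u_lim x (divr_gt0 s0 (ltr0n _ 2)).
  have ct : continuous (fun y => u (y + T *: e l)).
    by have cu := continuous_u; cts.
  have [d d0 hd] := continuous_ball_le x ct (divr_gt0 s0 (ltr0n _ 2)).
  exists ([set y : V | `|x - y| < d], [set T' : R | T <= T']) => /=.
    split; first by apply: (iffRL (nbhs_normP x _)); exists d.
    by apply: nbhs_pinfty_ge; exact: num_real.
  move=> [y T'] /= [hy hT'].
  have h1 := monotone_line y hT'.
  have : `|u (y + T *: e l) - u (x + T *: e l)| <= s / 2.
    by apply: hd; rewrite distrC ltW.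
  by rewrite ler_norml => /andP[]; lra.
near (pinfty_nbhs R) => T; exists T; last by move=> x hx; move: (near H T); apply.
by near: T; apply: nbhs_pinfty_ge; exact: num_real.
Unshelve. all: by end_near. Qed.

Definition energy_density (v : V -> R) x : R :=
  (\sum_j partial j v x ^+ 2) / 2 + (1 - v x ^+ 2) ^+ 2 / 4.

Lemma is_derive_energy_density x : is_derive x (e l) (energy_density u)
  (\sum_j partial j u x * partial j (partial l u) x - (u x - u x ^+ 3) * partial l u x).
Proof.
have g1 := has_gradient_sum (fun j => has_gradientM (gpu j) (gpu j)).
have g2 := has_gradientD (has_gradient_cst n (1 : R)) (has_gradientN (has_gradientM gu gu)).
have g := has_gradientD (has_gradientM g1 (has_gradient_cst n (2 : R)^-1))
   (has_gradientM (has_gradientM g2 g2) (has_gradient_cst n (4 : R)^-1)).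
have [_ _ d] := g; have := d l x.
rewrite (_ : (fun _ => _) = energy_density u); last first.
  by apply/funext => y; rewrite /energy_density; congr (_ / _ + _ / _).
move=> /is_derive_eq; apply.
have -> : \sum_(k < n.+1) (partial k u x * partial l (partial k u) x +
     partial k u x * partial l (partial k u) x) =
   2 * \sum_j partial j u x * partial j (partial l u) x.
  rewrite mulr_sumr; apply: eq_bigr => j _.
  by rewrite (solution_mixed l j x u_sol); ring.
by field.
Qed.

Lemma continuous_energy_density : continuous (energy_density u).
Proof.
have cu := continuous_u; have cpu := continuous_pu.
rewrite /energy_density; cts.
Qed.

Lemma energy_density_translate v x :
  energy_density (fun y => u (y + v)) x = energy_density u (x + v).
Proof.
have E : \sum_j partial j (fun y => u (y + v)) x ^+ 2 = \sum_j partial j u (x + v) ^+ 2.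
  by apply: eq_bigr => j _; rewrite (partial_translate _ _ (solution_C1 u_sol)).
by rewrite /energy_density E.
Qed.

Lemma gradient_dcutoff_le (r : R) x : 0 < r ->
  `|\sum_j partial j u x * dcutoff r j x| <= B * (6 / r * n.+1%:R) * cutoff (2 * r) x.
Proof.
move=> r0; apply: le_trans (ler_norm_sum _ _ _) _.
apply: (@le_trans _ _ (\sum_(j < n.+1) B * (6 / r * cutoff (2 * r) x))).
  apply: ler_sum => j _; rewrite normrM; apply: ler_pM => //.
  exact: dcutoff_le.
by rewrite sumr_const card_ord -(mulr_natr (B * _)) le_eqVlt; apply/orP; left; apply/eqP; ring.
Qed.

End Energy.

(** * The energy estimate *)

Section EnergyEstimate.
Variables (R : realType) (n : nat) (L : R).
Hypothesis L0 : 0 < L.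
Local Notation V := 'rV[R]_n.+1.
Local Notation e j := (@delta_mx R 1 n.+1 0 j).
Variables (a omega : R -> R).
Hypothesis a_cont : continuous a.
Hypothesis omega_gt0 : forall t, 0 < omega t.
Hypothesis omega_derive : forall t, is_derive t (1 : R) omega (- (a t * omega t)).
Implicit Types (x y v : V) (u : V -> R).
Local Notation w := (@weight R n omega).
Local Notation I := (integral L).
Variables (B : R) (l : 'I_n.+1).

Definition flux_constant (r : R) : R := B * (6 / r * n.+1%:R).

(** Sliding the solution upwards, its energy in the region of a cutoff can only
    change through the flux across the support of the gradient of the cutoff. *)
Lemma energy_flux_ge0 u (r : R) : classical_solution a u ->
  (forall j x, `|partial j u x| <= B) -> (forall x, 0 < partial l u x) ->
  0 < r -> 2 * r <= L ->
  0 <= I (fun x => w x * cutoff r x * (\sum_j partial j u x * partial j (partial l u) x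
      - (u x - u x ^+ 3) * partial l u x))
    + flux_constant r * I (fun x => w x * cutoff (2 * r) x * partial l u x).
Proof.
move=> sol grad_abs mono r0 rL; set c := flux_constant r.
have cw := continuous_weight (n := n) a_cont omega_derive.
have cu := continuous_u sol.
have cpu := continuous_pu sol; have cppu := continuous_ppu sol.
have gxi := has_gradientM (cutoff_gradient n r) (C1_gradient (solution_partial_C1 l sol)).
have [cc cdc _] := cutoff_gradient n r.
have [cc2 _ _] := cutoff_gradient n (2 * r).
have xi0 x : L <= `|x| -> cutoff r x * partial l u x = 0.
  by move=> hx; rewrite cutoff_support ?mul0r // (le_trans rL).
have := solution_weak L0 a_cont omega_derive sol gxi xi0.
set A := (X in I X = 0 -> _) => IA0.
have cA : continuous A by rewrite /A; cts.
rewrite -[X in _ <= X]subr0 -[X in _ <= _ - X]IA0 -(integralZ L0); last by cts.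
rewrite -(integralD L0); [|by cts..].
rewrite -(integralB L0) //; last by cts.
apply: (integral_ge0 L0); first by cts.
move=> x _; rewrite /A.
have E : \sum_j partial j u x * (cutoff r x * partial j (partial l u) x
      + partial l u x * dcutoff r j x) =
    cutoff r x * (\sum_j partial j u x * partial j (partial l u) x) +
    partial l u x * (\sum_j partial j u x * dcutoff r j x).
  rewrite !mulr_sumr -big_split; apply: eq_bigr => j _ /=; ring.
rewrite E.
have D := gradient_dcutoff_le grad_abs x r0.
set S1 := \sum_j _ * partial j (partial l u) x.
set S2 := \sum_j _ * dcutoff r j x in D *.
have -> : w x * cutoff r x * (S1 - (u x - u x ^+ 3) * partial l u x) +
   c * (w x * cutoff (2 * r) x * partial l u x) -
   w x * (cutoff r x * S1 + partial l u x * S2 -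
     cutoff r x * partial l u x * (u x - u x ^+ 3)) =
   w x * partial l u x * (c * cutoff (2 * r) x - S2) by ring.
rewrite mulr_ge0 ?mulr_ge0 ?(ltW (mono x)) ?(ltW (weight_gt0 omega_gt0 x)) //.
by rewrite subr_ge0 (le_trans (ler_norm _)).
Qed.

Definition rest_constant (r : R) : R := 3 + flux_constant r.

(** Testing the equation with [cutoff r * (u - 1)] trades the gradient part of the energy
    for terms that all carry the small factor [1 - u]. *)
Lemma energy_near_one u (r s : R) : classical_solution a u ->
  (forall x, `|u x| <= 1) -> (forall j x, `|partial j u x| <= B) ->
  (forall x, `|x| <= L -> 1 - u x <= s) -> 0 <= B -> 0 < r -> 2 * r <= L ->
  I (fun x => w x * cutoff r x * energy_density u x) <= s * (rest_constant r * I w).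
Proof.
move=> sol u1 grad_abs us B0 r0 rL.
have cw := continuous_weight (n := n) a_cont omega_derive.
have cu := continuous_u sol; have ce := continuous_energy_density sol.
have cpu := continuous_pu sol.
have gxi := has_gradientM (cutoff_gradient n r)
  (has_gradientD (C1_gradient (solution_C1 sol)) (has_gradient_cst n (- 1 : R))).
have [cc cdc _] := cutoff_gradient n r.
have xi0 x : L <= `|x| -> cutoff r x * (u x + - 1) = 0.
  by move=> hx; rewrite cutoff_support ?mul0r // (le_trans rL).
have := solution_weak L0 a_cont omega_derive sol gxi xi0.
set A := (X in I X = 0 -> _) => IA0.
have cA : continuous A by rewrite /A; cts.
rewrite mulrA -(integralZ L0) // -[X in X <= _]subr0 -[X in _ - X <= _](mulr0 2^-1).
rewrite -[X in _ - _ * X <= _]IA0 -[X in _ - X <= _](integralZ L0) //.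
rewrite -(integralB L0); [|by cts..].
apply: (integral_le L0); [by cts|by cts|].
move=> x hx; rewrite /A /energy_density.
have E : \sum_j partial j u x * (cutoff r x * (partial j u x + 0)
      + (u x + - 1) * dcutoff r j x) =
    cutoff r x * (\sum_j partial j u x ^+ 2) -
    (1 - u x) * (\sum_j partial j u x * dcutoff r j x).
  rewrite !mulr_sumr -sumrB; apply: eq_bigr => j _ /=; ring.
rewrite E.
have D := gradient_dcutoff_le grad_abs x r0.
have f1 := cubic_le1 (u1 x).
have /andP[c0 c1] := cutoff_in01 r x.
have /andP[c20 c21] := cutoff_in01 (2 * r) x.
have w0 := weight_gt0 omega_gt0 x.
set S1 := \sum_j _ ^+ 2.
set S2 := \sum_j _ * dcutoff r j x in D *.
have u0 : 0 <= 1 - u x by have := u1 x; rewrite ler_norml => /andP[_]; rewrite subr_ge0.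
have -> : w x * cutoff r x * (S1 / 2 + (1 - u x ^+ 2) ^+ 2 / 4) -
   2^-1 * (w x * (cutoff r x * S1 - (1 - u x) * S2 -
     cutoff r x * (u x + - 1) * (u x - u x ^+ 3))) =
   w x * ((1 - u x) * (cutoff r x * ((1 - u x) * (1 + u x) ^+ 2 / 4
      - (u x - u x ^+ 3) / 2) + S2 / 2)) by field.
rewrite [leRHS]mulrC; apply: ler_wpM2l; first exact: ltW.
have k0 : 0 <= flux_constant r.
  by rewrite /flux_constant mulr_ge0 // mulr_ge0 // divr_ge0 // ltW.
have S2c : S2 <= flux_constant r.
  apply: le_trans (ler_norm _) _; apply: le_trans D _.
  by rewrite -[leRHS]mulr1; apply: ler_wpM2l.
have P1 : (1 - u x) * (1 + u x) ^+ 2 / 4 - (u x - u x ^+ 3) / 2 <= 3.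
  have h1 := u1 x; rewrite ler_norml in h1; have /andP[h2 h3] := h1.
  have h4 : (1 + u x) ^+ 2 <= 4.
    have -> : (4 : R) = 2 ^+ 2 by ring.
    by rewrite ler_pXn2r ?nnegrE //; lra.
  have h5 : (1 - u x) * (1 + u x) ^+ 2 <= 2 * 4.
    by apply: ler_pM => //; [exact: sqr_ge0|lra].
  by move: f1; rewrite ler_norml => /andP[f1 f2]; lra.
apply: (@le_trans _ _ ((1 - u x) * rest_constant r)).
  apply: ler_wpM2l => //; rewrite /rest_constant; apply: lerD.
    have := ler_wpM2l c0 P1; move=> /le_trans; apply.
    by rewrite -[leRHS]mul1r; apply: ler_wpM2r.
  by lra.
apply: ler_wpM2r; last exact: us.
by rewrite /rest_constant addr_ge0.
Qed.

Variable u : V -> R.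
Hypothesis u_sol : classical_solution a u.
Hypothesis l0 : l != ord0.
Hypothesis u_abs : forall x, `|u x| <= 1.
Hypothesis grad_abs : forall j x, `|partial j u x| <= B.
Hypothesis u_mono : forall x, 0 < partial l u x.
Hypothesis u_lim : forall x (s : R), 0 < s -> exists T : R, 1 - u (x + T *: e l) <= s.

(** The energy of the upward translates tends to zero, hence the energy of [u] is at
    most the total flux, in which the monotone direction integrates out. *)
Lemma energy_le_flux (r : R) : 0 < r -> 2 * r <= L ->
  I (fun x => w x * cutoff r x * energy_density u x) <=
    flux_constant r * (2 * I (fun x => w x * cutoff (2 * r) x)).
Proof.
move=> r0 rL.
have B0 : 0 <= B by apply: le_trans (normr_ge0 _) (grad_abs ord0 0).
have k0 : 0 <= flux_constant r.
  by rewrite /flux_constant mulr_ge0 // mulr_ge0 // divr_ge0 // ltW.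
have cw := continuous_weight (n := n) a_cont omega_derive.
have cu := continuous_u u_sol; have ce := continuous_energy_density u_sol.
have cpu := continuous_pu u_sol; have cppu := continuous_ppu u_sol.
have [cc _ _] := cutoff_gradient n r.
have [cc2 _ _] := cutoff_gradient n (2 * r).
pose c := flux_constant r; rewrite -/c in k0 *.
pose E t := I (fun x => w x * cutoff r x * energy_density u (x + t *: e l)).
pose F t := I (fun x => w x * cutoff (2 * r) x * u (x + t *: e l)).
pose de x := \sum_j partial j u x * partial j (partial l u) x - (u x - u x ^+ 3) * partial l u x.
have cde : continuous de by rewrite /de; cts.
pose dE t := I (fun x => w x * cutoff r x * de (x + t *: e l)).
pose dF t := I (fun x => w x * cutoff (2 * r) x * partial l u (x + t *: e l)).
have hE t : is_derive t (1 : R) E (dE t).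
  apply: (is_derive_integral L0) => //; first by cts.
  exact: (is_derive_energy_density u_sol).
have hF t : is_derive t (1 : R) F (dF t).
  apply: (is_derive_integral L0) => //; first by cts.
  by have [_ _ d] := C1_gradient (solution_C1 u_sol); exact: d.
have hQ t : is_derive t (1 : R) (fun t => E t + c * F t) (dE t + c * dF t).
  exact: (@is_deriveD _ _ _ E (c \*: F)).
have dQ0 t : 0 <= dE t + c * dF t.
  have v0 := translate_coord0 t l0.
  have C1u := solution_C1 u_sol.
  have sol := solution_translate v0 u_sol.
  have [ut utE] : exists ut, ut = (fun x => u (x + t *: e l)) by eexists.
  rewrite -utE in sol.
  have uE x : ut x = u (x + t *: e l) by rewrite utE.
  have P j x : partial j ut x = partial j u (x + t *: e l).
    by rewrite utE (partial_translate _ _ C1u).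
  have PP j x : partial j (partial l ut) x = partial j (partial l u) (x + t *: e l).
    by rewrite utE !(partial_translate _ _ _) //; exact: solution_partial_C1 u_sol.
  have E1 x : \sum_j partial j ut x * partial j (partial l ut) x =
      \sum_j partial j u (x + t *: e l) * partial j (partial l u) (x + t *: e l).
    by apply: eq_bigr => j _; rewrite P PP.
  have <- : I (fun x => w x * cutoff r x *
      (\sum_j partial j ut x * partial j (partial l ut) x
        - (ut x - ut x ^+ 3) * partial l ut x)) = dE t.
    by congr integral; apply/funext => x; rewrite E1 uE P.
  have <- : I (fun x => w x * cutoff (2 * r) x * partial l ut x) = dF t.
    by congr integral; apply/funext => x; rewrite P.
  by apply: energy_flux_ge0 => // [j x|x]; rewrite P.
have EF0 T : 0 <= T -> E 0 + c * F 0 <= E T + c * F T.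
  move=> T0; have cQ : continuous (fun t => E t + c * F t).
    exact: (derive_continuous1 hQ).
  have [z _ Ez] := MVT_segment T0 (fun t _ => hQ t) (continuous_subspaceT cQ).
  by rewrite -subr_ge0 Ez subr0 mulr_ge0.
have w0 x : 0 <= w x by exact: ltW (weight_gt0 omega_gt0 x).
have FT T : F T - F 0 <= 2 * I (fun x => w x * cutoff (2 * r) x).
  rewrite -(integralB L0) -?(integralZ L0); [|by cts..].
  apply: (integral_le L0); [by cts|by cts|] => x _.
  have /andP[c20 _] := cutoff_in01 (2 * r) x.
  rewrite -mulrBr [leRHS]mulrC; apply: ler_wpM2l; first exact: mulr_ge0.
  have := u_abs (x + T *: e l); have := u_abs (x + 0 *: e l).
  by rewrite !ler_norml => /andP[? ?] /andP[? ?]; lra.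
have E0 : I (fun x => w x * cutoff r x * energy_density u x) = E 0.
  by congr integral; apply/funext => x; rewrite scale0r addr0.
rewrite E0; apply/ler_addgt0Pr => eps eps0.
pose K := rest_constant r * I w.
have K0 : 0 <= K.
  rewrite /K mulr_ge0 //; first by rewrite /rest_constant addr_ge0.
  by apply: (integral_ge0 L0) => // x _.
have K10 : 0 < K + 1 by rewrite ltr_wpDl.
have [T T0 hT] := uniform_limit L u_sol u_mono u_lim (divr_gt0 eps0 K10).
have ET : E T <= eps.
  have sol := solution_translate (translate_coord0 T l0) u_sol.
  have -> : E T = I (fun x => w x * cutoff r x *
      energy_density (fun y => u (y + T *: e l)) x).
    by congr integral; apply/funext => x; rewrite (energy_density_translate u_sol).
  have g1 j x : `|partial j (fun y => u (y + T *: e l)) x| <= B.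
    by rewrite (partial_translate _ _ (solution_C1 u_sol)); exact: grad_abs.
  apply: le_trans (energy_near_one sol (fun x => u_abs _) g1 hT B0 r0 rL) _.
  rewrite -/K mulrAC ler_pdivrMr //.
  by apply: ler_wpM2l; [exact: ltW|rewrite lerDl].
have h1 := EF0 T T0; have h2 := ler_wpM2l k0 (FT T).
by move: h2; rewrite mulrBr; lra.
Qed.

(** It matters that the constant depends neither on [r] nor on the size of the box. *)
Lemma gradient_energy_le (r : R) : 0 < r -> 2 * r <= L ->
  I (fun x => w x * cutoff r x * \sum_j partial j u x ^+ 2) <=
    24 * B * n.+1%:R / r * I (fun x => w x * cutoff (2 * r) x).
Proof.
move=> r0 rL.
have cw := continuous_weight (n := n) a_cont omega_derive.
have cu := continuous_u u_sol; have ce := continuous_energy_density u_sol.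
have cpu := continuous_pu u_sol.
have [cc _ _] := cutoff_gradient n r.
apply: (@le_trans _ _ (2 * I (fun x => w x * cutoff r x * energy_density u x))).
  rewrite -(integralZ L0); last by cts.
  apply: (integral_le L0); [by cts|by cts|] => x _.
  rewrite mulrCA; apply: ler_wpM2l.
    have /andP[c0 _] := cutoff_in01 r x.
    by apply: mulr_ge0 => //; exact: ltW (weight_gt0 omega_gt0 x).
  by rewrite /energy_density; have := sqr_ge0 (1 - u x ^+ 2); lra.
apply: le_trans (ler_wpM2l _ (energy_le_flux r0 rL)) _ => //.
by rewrite le_eqVlt; apply/orP; left; apply/eqP; rewrite /flux_constant; field; exact: lt0r_neq0.
Qed.

End EnergyEstimate.

(** * A Liouville theorem *)

Lemma weighted_amgm (R : realFieldType) (lam h q d k : R) : 0 < lam ->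
  - (2 * h * q * d * k) <= lam * h ^+ 2 * d ^+ 2 + lam^-1 * q ^+ 2 * k ^+ 2.
Proof.
move=> lam0; rewrite -subr_ge0.
have -> : lam * h ^+ 2 * d ^+ 2 + lam^-1 * q ^+ 2 * k ^+ 2 - - (2 * h * q * d * k) =
    lam^-1 * (lam * h * d + q * k) ^+ 2 by field; exact: lt0r_neq0.
by rewrite mulr_ge0 ?sqr_ge0 // invr_ge0 ltW.
Qed.

Section Liouville.
Variables (R : realType) (n : nat).
Local Notation V := 'rV[R]_n.+1.
Local Notation e j := (@delta_mx R 1 n.+1 0 j).
Variables (a omega : R -> R).
Hypothesis a_cont : continuous a.
Hypothesis omega_gt0 : forall t, 0 < omega t.
Hypothesis omega_derive : forall t, is_derive t (1 : R) omega (- (a t * omega t)).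
Implicit Types (x y v : V) (r : R).
Local Notation w := (@weight R n omega).
Variables (u : V -> R) (B : R) (l i : 'I_n.+1).
Hypothesis u_sol : classical_solution a u.
Hypothesis l0 : l != ord0.
Hypothesis i0 : i != ord0.
Hypothesis u_abs : forall x, `|u x| <= 1.
Hypothesis grad_abs : forall j x, `|partial j u x| <= B.
Hypothesis u_mono : forall x, 0 < partial l u x.
Hypothesis u_lim : forall x (s : R), 0 < s -> exists T : R, 1 - u (x + T *: e l) <= s.

Definition slope x : R := partial i u x * (partial l u x)^-1.
Definition dslope (j : 'I_n.+1) x : R :=
  (partial l u x * partial j (partial i u) x
    - partial i u x * partial j (partial l u) x) * (partial l u x) ^- 2.

Lemma slope_gradient : has_gradient slope dslope.
Proof.
have h x : partial l u x != 0 by exact: lt0r_neq0.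
have := has_gradientM (C1_gradient (solution_partial_C1 i u_sol))
  (has_gradientV h (C1_gradient (solution_partial_C1 l u_sol))).
move=> /has_gradient_eq; apply => j x; rewrite /dslope.
by move: (h x); gen_atoms => hx; field.
Qed.

Definition slope_energy x : R := partial l u x ^+ 2 * \sum_j dslope j x ^+ 2.

Lemma continuous_slope_energy : continuous slope_energy.
Proof.
have cpu := continuous_pu u_sol; have [_ cds _] := slope_gradient.
rewrite /slope_energy; cts.
Qed.

Lemma slope_energy_ge0 x : 0 <= slope_energy x.
Proof. by rewrite mulr_ge0 ?sqr_ge0 // sumr_ge0 // => j _; exact: sqr_ge0. Qed.

Section Box.
Variable L : R.
Hypothesis L0 : 0 < L.
Local Notation I := (integral L).

Definition local_energy r : R := I (fun x => w x * cutoff r x ^+ 2 * slope_energy x).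
Definition cutoff_error r : R :=
  I (fun x => w x * partial i u x ^+ 2 * \sum_j dcutoff r j x ^+ 2).

(** The slope solves [div (w (partial l u)^2 grad slope) = 0]: this is the difference
    of the linearized equations of the two partial derivatives. *)
Lemma slope_weak z dz : has_gradient z dz -> (forall x, L <= `|x| -> z x = 0) ->
  I (fun x => w x * (partial l u x ^+ 2 * \sum_j dslope j x * dz j x)) = 0.
Proof.
move=> gz z0; have [cz cdz _] := gz.
have cw := continuous_weight (n := n) a_cont omega_derive.
have cu := continuous_u u_sol.
have cpu := continuous_pu u_sol; have cppu := continuous_ppu u_sol.
have g1 := has_gradientM (C1_gradient (solution_partial_C1 l u_sol)) gz.
have g2 := has_gradientM (C1_gradient (solution_partial_C1 i u_sol)) gz.
have s1 x : L <= `|x| -> partial l u x * z x = 0 by move=> /z0 ->; rewrite mulr0.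
have s2 x : L <= `|x| -> partial i u x * z x = 0 by move=> /z0 ->; rewrite mulr0.
have := linearized_weak L0 a_cont omega_derive u_sol i0 g1 s1.
have := linearized_weak L0 a_cont omega_derive u_sol l0 g2 s2.
set A1 := (X in I X = 0 -> _) => e1; set A2 := (X in I X = 0 -> _) => e2.
have c1 : continuous A1 by rewrite /A1; cts.
have c2 : continuous A2 by rewrite /A2; cts.
have : I A2 - I A1 = 0 by exact: etrans (congr2 (fun s t => s - t) e2 e1) (subrr 0).
rewrite -(integralB L0) // => E; rewrite -[RHS]E; congr integral.
apply/funext => x; rewrite /A1 /A2 -mulrBr; congr (_ * _).
have hx : partial l u x != 0 by exact: lt0r_neq0.
have -> : partial l u x ^+ 2 * \sum_j dslope j x * dz j x =
   \sum_j (partial j (partial i u) x * (partial l u x * dz j x + z x * partial j (partial l u) x)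
     - partial j (partial l u) x * (partial i u x * dz j x + z x * partial j (partial i u) x)).
  rewrite mulr_sumr; apply: eq_bigr => j _; rewrite /dslope.
  by move: hx; gen_atoms => hx; field.
have cancel (t1 t2 z1 p q f : R) :
    t1 - t2 = t1 - p * z1 * (f * q) - (t2 - q * z1 * (f * p)) by ring.
rewrite sumrB; exact: cancel.
Qed.

Local Opaque dslope dcutoff cutoff.

(** Caccioppoli's inequality, from the test function [cutoff ^+ 2 * slope]. The cross term
    only lives where the gradient of the larger cutoff does not vanish; the smaller cutoff
    vanishes there, so only the energy gained between the two scales appears on the
    right. *)
Lemma local_energy_step r (lam : R) : 0 < r -> 2 * (2 * r) <= L -> 0 < lam ->
  local_energy (2 * r) <=
    lam * (local_energy (2 * r) - local_energy r) + lam^-1 * cutoff_error (2 * r).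
Proof.
move=> r0 rL lam0; have r20 : 0 < 2 * r by rewrite mulr_gt0.
have cw := continuous_weight (n := n) a_cont omega_derive.
have cpu := continuous_pu u_sol; have cse := continuous_slope_energy.
have gc := cutoff_gradient n (2 * r); have [cc cdc _] := gc.
have [cc1 _ _] := cutoff_gradient n r.
have [cs cds _] := slope_gradient.
have gz := has_gradientM (has_gradientM gc gc) slope_gradient.
have z0 x : L <= `|x| -> cutoff (2 * r) x * cutoff (2 * r) x * slope x = 0.
  by move=> hx; rewrite cutoff_support ?mul0r // (le_trans rL).
have := slope_weak gz z0; set A := (X in I X = 0 -> _) => e1.
have cA : continuous A by rewrite /A; cts.
rewrite /local_energy /cutoff_error -[X in X <= _]subr0 -[X in _ - X <= _]e1.
rewrite -!(integralB L0); [|by cts..].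
rewrite -!(integralZ L0); [|by cts..].
rewrite -(integralD L0); [|by cts..].
apply: (integral_le L0); [by cts|by cts|] => x _.
rewrite /A /slope_energy.
set p := partial l u x; set q := partial i u x.
have p0 : p != 0 by exact: lt0r_neq0 (u_mono x).
have W0 := ltW (weight_gt0 omega_gt0 x).
set W := w x in W0 *; set h := cutoff (2 * r) x; set h' := cutoff r x.
have E : \sum_j dslope j x * (h * h * dslope j x + slope x * (h * dcutoff (2 * r) j x
     + h * dcutoff (2 * r) j x)) =
   h ^+ 2 * \sum_j dslope j x ^+ 2 + \sum_j 2 * h * slope x * dslope j x * dcutoff (2 * r) j x.
  rewrite mulr_sumr -big_split; apply: eq_bigr => j _ /=; ring.
rewrite E.
have -> : W * h ^+ 2 * (p ^+ 2 * \sum_j dslope j x ^+ 2) - W * (p ^+ 2 *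
    (h ^+ 2 * \sum_j dslope j x ^+ 2 + \sum_j 2 * h * slope x * dslope j x * dcutoff (2 * r) j x)) =
  W * \sum_j - (2 * h * (p * slope x) * (p * dslope j x) * dcutoff (2 * r) j x).
  rewrite sumrN mulrDr mulrN (_ : \sum_j 2 * h * (p * slope x) * (p * dslope j x) * dcutoff (2 * r) j x =
    p ^+ 2 * \sum_j 2 * h * slope x * dslope j x * dcutoff (2 * r) j x); first ring.
  by rewrite mulr_sumr; apply: eq_bigr => j _; ring.
have -> : p * slope x = q by rewrite /slope -/p -/q mulrC divfK.
have -> : lam * (W * h ^+ 2 * (p ^+ 2 * \sum_j dslope j x ^+ 2) -
     W * h' ^+ 2 * (p ^+ 2 * \sum_j dslope j x ^+ 2)) +
    lam^-1 * (W * q ^+ 2 * \sum_j dcutoff (2 * r) j x ^+ 2) =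
   W * \sum_j (lam * (h ^+ 2 - h' ^+ 2) * (p * dslope j x) ^+ 2
     + lam^-1 * q ^+ 2 * dcutoff (2 * r) j x ^+ 2).
  rewrite big_split /= -[X in W * (_ + X)]mulr_sumr.
  rewrite (_ : \sum_j lam * (h ^+ 2 - h' ^+ 2) * (p * dslope j x) ^+ 2 =
     lam * (h ^+ 2 - h' ^+ 2) * p ^+ 2 * \sum_j dslope j x ^+ 2); first ring.
  by rewrite mulr_sumr; apply: eq_bigr => j _; ring.
apply: ler_wpM2l => //; apply: ler_sum => j _.
set d := p * dslope j x; set k := dcutoff (2 * r) j x.
have hh : 0 <= h' /\ h' <= h.
  by have /andP[c0 _] := cutoff_in01 r x; split=> //; exact: cutoff_le_double.
case: hh => h'0 h'h.
have [k0|k0] := eqVneq k 0.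
  rewrite k0 expr0n /= !mulr0 oppr0 addr0 mulr_ge0 ?sqr_ge0 // mulr_ge0 ?(ltW lam0) //.
  by rewrite subr_ge0 ler_pXn2r ?nnegrE // (le_trans h'0).
have -> : h' = 0 by apply: (@cutoff_nested _ _ r j x r0); exact/eqP.
rewrite expr0n /= subr0.
exact: weighted_amgm.
Qed.

Lemma cutoff_error_le r : 0 < r -> 2 * (4 * r) <= L ->
  cutoff_error (2 * r) <=
    54 * B * n.+1%:R ^+ 2 / r ^+ 3 * I (fun x => w x * cutoff (8 * r) x).
Proof.
move=> r0 rL; have r20 : 0 < 2 * r by rewrite mulr_gt0.
have r40 : 0 < 4 * r by rewrite mulr_gt0.
have cw := continuous_weight (n := n) a_cont omega_derive.
have cpu := continuous_pu u_sol.
have [_ cdc _] := cutoff_gradient n (2 * r).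
have [cc4 _ _] := cutoff_gradient n (4 * r).
apply: (@le_trans _ _ (9 * n.+1%:R / r ^+ 2 *
    I (fun x => w x * cutoff (4 * r) x * \sum_j partial j u x ^+ 2))).
  rewrite /cutoff_error -(integralZ L0); last by cts.
  apply: (integral_le L0); [by cts|by cts|] => x _.
  have W0 := ltW (weight_gt0 omega_gt0 x).
  have /andP[c0 c1] := cutoff_in01 (4 * r) x.
  have qS : partial i u x ^+ 2 <= \sum_j partial j u x ^+ 2.
    by rewrite (bigD1 i) //= lerDl sumr_ge0 // => j _; exact: sqr_ge0.
  have kS : \sum_j dcutoff (2 * r) j x ^+ 2 <= 9 * n.+1%:R / r ^+ 2 * cutoff (4 * r) x.
    apply: (@le_trans _ _ (\sum_(j < n.+1) 9 / r ^+ 2 * cutoff (4 * r) x)).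
      apply: ler_sum => j _.
      have := @dcutoff_le _ _ (2 * r) j x r20.
      have -> : 2 * (2 * r) = 4 * r by ring.
      have -> : 6 / (2 * r) = 3 / r by field; exact: lt0r_neq0.
      move=> hk; rewrite -real_normK ?num_real //.
      apply: (@le_trans _ _ ((3 / r * cutoff (4 * r) x) ^+ 2)).
        by rewrite ler_pXn2r ?nnegrE // mulr_ge0 // divr_ge0 // ltW.
      rewrite exprMn (_ : (3 / r) ^+ 2 = 9 / r ^+ 2); last by field; exact: lt0r_neq0.
      apply: ler_wpM2l; first by rewrite divr_ge0 // sqr_ge0.
      by rewrite expr2 -[leRHS]mulr1; apply: ler_wpM2l.
    rewrite sumr_const card_ord -(mulr_natr (9 / _ * _)) le_eqVlt; apply/orP; left.
    by apply/eqP; ring.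
  have D0 : 0 <= \sum_j dcutoff (2 * r) j x ^+ 2.
    by apply: sumr_ge0 => j _; exact: sqr_ge0.
  have step := ler_wpM2l W0 (ler_pM (sqr_ge0 _) D0 qS kS).
  rewrite -mulrA; apply: le_trans step _.
  by rewrite le_eqVlt; apply/orP; left; apply/eqP; gen_atoms; ring.
have C0 : 0 <= 9 * n.+1%:R / r ^+ 2 by rewrite divr_ge0 ?sqr_ge0.
apply: le_trans (ler_wpM2l C0 (gradient_energy_le L0 a_cont omega_gt0 omega_derive
   u_sol l0 u_abs grad_abs u_mono u_lim r40 rL)) _.
have -> : 2 * (4 * r) = 8 * r by ring.
rewrite le_eqVlt; apply/orP; left; apply/eqP; field; exact: lt0r_neq0.
Qed.

Lemma local_energy_ge0 r : 0 <= local_energy r.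
Proof.
have cw := continuous_weight (n := n) a_cont omega_derive.
have cse := continuous_slope_energy; have [cc _ _] := cutoff_gradient n r.
apply: (integral_ge0 L0); first by cts.
move=> x _; rewrite mulr_ge0 ?slope_energy_ge0 // mulr_ge0 ?sqr_ge0 //.
exact: ltW (weight_gt0 omega_gt0 x).
Qed.

Lemma local_energy_mono r : 0 < r -> local_energy r <= local_energy (2 * r).
Proof.
move=> r0.
have cw := continuous_weight (n := n) a_cont omega_derive.
have cse := continuous_slope_energy; have [cc _ _] := cutoff_gradient n r.
have [cc2 _ _] := cutoff_gradient n (2 * r).
apply: (integral_le L0); [by cts|by cts|] => x _.
apply: ler_wpM2r; first exact: slope_energy_ge0.
apply: ler_wpM2l; first exact: ltW (weight_gt0 omega_gt0 x).
have /andP[c0 _] := cutoff_in01 r x.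
rewrite ler_pXn2r ?nnegrE //; first exact: cutoff_le_double.
by have /andP[] := cutoff_in01 (2 * r) x.
Qed.

End Box.

(** The choice of the parameter that optimizes Caccioppoli's inequality turns it into
    a recursion that telescopes. *)
Lemma inverse_gap (A A' K : R) : 0 < A' -> A' <= A -> 0 < K ->
  (forall lam, 0 < lam -> A <= lam * (A - A') + lam^-1 * K) ->
  (4 * K)^-1 <= A'^-1 - A^-1.
Proof.
move=> A'0 AA' K0 h; have A0 : 0 < A by exact: lt_le_trans AA'.
(* the second term on the right becomes half of the left-hand side *)
have := h (2 * K / A); rewrite divr_gt0 ?mulr_gt0 // => /(_ isT).
have -> : (2 * K / A)^-1 * K = A / 2 by field; rewrite !lt0r_neq0.
move=> h1.
have h2 : A ^+ 2 <= 4 * K * (A - A').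
  have : A / 2 * (2 * A) <= 2 * K / A * (A - A') * (2 * A).
    by rewrite ler_pM2r ?mulr_gt0 //; lra.
  have -> : A / 2 * (2 * A) = A ^+ 2 by field.
  by have -> : 2 * K / A * (A - A') * (2 * A) = 4 * K * (A - A') by field; rewrite lt0r_neq0.
have -> : A'^-1 - A^-1 = (A - A') / (A' * A) by field; rewrite !lt0r_neq0.
rewrite ler_pdivlMr ?mulr_gt0 // mulrC ler_pdivrMr ?mulr_gt0 // mulrC.
rewrite [leRHS]mulrC; apply: le_trans h2; rewrite expr2.
by rewrite [leLHS]mulrC; apply: ler_wpM2r => //; exact: ltW.
Qed.

Variables (g : R -> R) (C : R).
Hypothesis g_gt0 : forall t, 0 < t -> 0 < g t.
Hypothesis g_sum : forall (j0 : nat) (M : R),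
  exists J : nat, M < \sum_(j0 <= j < J) (g (2 ^+ j))^-1.
Hypothesis volume : forall (L : R) (j : nat), 0 < L ->
  integral L (fun x => w x * cutoff (8 * 2 ^+ j) x) <= C * (2 ^+ j) ^+ 3 * g (2 ^+ (j + 5)).
Hypothesis C0 : 0 <= C.

(** If the gradient of the slope were nonzero at [x0], the energies at large scales would
    be bounded below uniformly in the size of the box, and [inverse_gap] would bound the
    sums of [1 / g (2^j)]. *)
Theorem slope_gradient_eq0 j x : dslope j x = 0.
Proof.
pose x0 := x; suff : slope_energy x0 <= 0.
  move=> h; have S0 : \sum_k dslope k x0 ^+ 2 <= 0.
    have p0 : 0 < partial l u x0 ^+ 2 by rewrite exprn_gt0.
    by rewrite -(pmulr_rle0 _ p0).
  have : dslope j x0 ^+ 2 <= 0.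
    apply: le_trans S0; rewrite (bigD1 j) //= lerDl sumr_ge0 // => k _.
    exact: sqr_ge0.
  by move=> h2; apply/eqP; rewrite -sqrf_eq0 eq_le h2 sqr_ge0.
rewrite leNgt; apply/negP => E0.
have B0 : 0 <= B by apply: le_trans (normr_ge0 _) (grad_abs ord0 0).
have cw := continuous_weight (n := n) a_cont omega_derive.
have cse := continuous_slope_energy.
(* a scale at which x0 lies where the cutoff is constant *)
have [j0 hj0] : exists j0 : nat, sqdist 0 x0 <= (2 ^+ j0) ^+ 2.
  exists (Num.truncn (sqdist 0 x0)).+1.
  have s0 : 0 <= sqdist 0 x0 by apply: sumr_ge0 => k _; exact: sqr_ge0.
  set N := (Num.truncn _).+1.
  have h1 : sqdist 0 x0 <= N%:R by exact: ltW (truncnS_gt _).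
  have h2 : N%:R <= 2 ^+ N :> R by rewrite -natrX ler_nat ltnW // ltn_expl.
  have h3 : 1 <= 2 ^+ N :> R by rewrite exprn_ege1 // ler1n.
  by apply: le_trans h1 _; apply: le_trans h2 _; rewrite expr2 ler_peMr // ltW // (lt_le_trans ltr01).
have p2 k : 0 < 2 ^+ k :> R by rewrite exprn_gt0.
pose F y := w y * cutoff (2 ^+ j0) y ^+ 2 * slope_energy y.
have cF : continuous F by have [cc _ _] := cutoff_gradient n (2 ^+ j0 : R); rewrite /F; cts.
have F0 y : 0 <= F y.
  rewrite mulr_ge0 ?slope_energy_ge0 // mulr_ge0 ?sqr_ge0 //.
  exact: ltW (weight_gt0 omega_gt0 y).
have Fx0 : 0 < F x0.
  have [cx _] := cutoff_inner (p2 j0) hj0.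
  by rewrite /F cx expr1n mulr1 mulr_gt0 // (weight_gt0 omega_gt0).
have Fx20 : 0 < F x0 / 2 by rewrite divr_gt0.
have [del del0 hdel] := continuous_ball_le x0 cF Fx20.
pose c := F x0 / 2 * del ^+ n.+1.
have c0 : 0 < c by rewrite mulr_gt0 // exprn_gt0.
(* 1 is added to keep K positive when C is zero *)
pose K := 54 * B * n.+1%:R ^+ 2 * C + 1.
have K0 : 0 < K by rewrite ltr_wpDl // !mulr_ge0.
have [J hJ] := g_sum (j0 + 5) (4 * K / c).
have Jj0 : (j0 + 5 <= J)%N.
  rewrite leqNgt; apply/negP => h; move: hJ; rewrite big_geq ?(ltnW h) //.
  rewrite ltNge => /negP; apply; apply: divr_ge0; last exact: ltW.
  by apply: mulr_ge0 => //; exact: ltW.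
(* the box contains the ball around x0 and the cutoffs of all scales below J *)
pose L := `|x0| + del + 8 * 2 ^+ J.
have L0 : 0 < L.
  by apply: ltr_wpDl; [rewrite addr_ge0 // ltW|rewrite mulr_gt0 ?p2].
have base : c <= local_energy L (2 ^+ j0).
  apply: (@integral_ge_ball _ _ _ L0 F x0 (F x0 / 2) del) => //; first exact: ltW.
    by rewrite /L lerDl mulr_ge0 // ltW.
  by move=> y /hdel; rewrite ler_norml => /andP[+ _]; lra.
have A_ge k : (j0 <= k)%N -> c <= local_energy L (2 ^+ k).
  elim: k => [|k IH].
    by rewrite leqn0 => /eqP j00; move: base; rewrite j00.
  rewrite leq_eqVlt => /predU1P[j0k|]; first by rewrite -j0k; exact: base.
  rewrite ltnS => /IH h; apply: le_trans h _.
  by rewrite exprS; apply: local_energy_mono.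
have step k : (j0 <= k)%N -> (k < J)%N ->
    (4 * K)^-1 * (g (2 ^+ (k + 5)))^-1 <=
      (local_energy L (2 ^+ k))^-1 - (local_energy L (2 ^+ k.+1))^-1.
  move=> j0k kJ; have gk := g_gt0 (p2 (k + 5)%N).
  have kJ2 : 2 ^+ k <= 2 ^+ J :> R by rewrite ler_eXn2l ?ltr1n // ltnW.
  have kL : 8 * 2 ^+ k <= L.
    rewrite /L; have := normr_ge0 x0; lra.
  rewrite -invfM -mulrA; apply: inverse_gap.
  - exact: lt_le_trans c0 (A_ge _ j0k).
  - by rewrite exprS; exact: local_energy_mono.
  - exact: mulr_gt0.
  move=> lam lam0; rewrite exprS.
  have kL4 : 2 * (2 * 2 ^+ k) <= L by have := p2 k; lra.
  have kL8 : 2 * (4 * 2 ^+ k) <= L by lra.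
  apply: le_trans (local_energy_step L0 (p2 k) kL4 lam0) _.
  apply: lerD => //; apply: ler_wpM2l; first by rewrite invr_ge0 ltW.
  apply: le_trans (cutoff_error_le L0 (p2 k) kL8) _.
  have D0 : 0 <= 54 * B * n.+1%:R ^+ 2 / (2 ^+ k) ^+ 3.
    by rewrite divr_ge0 ?mulr_ge0 // exprn_ge0 // ltW.
  apply: le_trans (ler_wpM2l D0 (volume k L0)) _.
  have -> : 54 * B * n.+1%:R ^+ 2 / (2 ^+ k) ^+ 3 * (C * (2 ^+ k) ^+ 3 * g (2 ^+ (k + 5)))
     = 54 * B * n.+1%:R ^+ 2 * C * g (2 ^+ (k + 5)) by field; exact: lt0r_neq0.
  by apply: ler_wpM2r; [exact: ltW|rewrite /K lerDl].
have sum_le m : (\sum_(j0 <= k < j0 + m) (4 * K)^-1 * (g (2 ^+ (k + 5)))^-1 <=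
     (local_energy L (2 ^+ j0))^-1 - (local_energy L (2 ^+ (j0 + m)))^-1) \/ (J < j0 + m)%N.
  elim: m => [|m [IH|IH]]; first by left; rewrite addn0 big_geq // subrr.
    have [h|h] := ltnP (j0 + m) J; last by right; rewrite addnS ltnS.
    left; rewrite addnS big_nat_recr ?leq_addr //=.
    by have := step _ (leq_addr m j0) h; lra.
  by right; rewrite addnS ltnW // ltnS.
pose m := (J - (j0 + 5))%N.
have JE : (j0 + 5 + m)%N = J by rewrite subnKC.
have mJ : (j0 + m <= J)%N by rewrite -JE addnAC leq_addr.
have [|] := sum_le m; last by rewrite ltnNge mJ.
rewrite -mulr_sumr => h.
have hs : \sum_(j0 <= k < j0 + m) (g (2 ^+ (k + 5)))^-1 =
    \sum_(j0 + 5 <= k < J) (g (2 ^+ k))^-1.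
  by rewrite [RHS]big_addn -JE addnAC addnK.
move: h; rewrite hs => h.
have h1 : (local_energy L (2 ^+ j0))^-1 <= c^-1.
  have h3 := A_ge _ (leqnn j0); rewrite lef_pV2 ?posrE //; exact: lt_le_trans h3.
have h2 : 0 <= (local_energy L (2 ^+ (j0 + m)))^-1.
  by rewrite invr_ge0; exact: local_energy_ge0.
have : (4 * K)^-1 * (4 * K / c) < (4 * K)^-1 * \sum_(j0 + 5 <= k < J) (g (2 ^+ k))^-1.
  by rewrite ltr_pM2l // invr_gt0 mulr_gt0.
rewrite mulKf; last by rewrite lt0r_neq0 // mulr_gt0.
lra.
Qed.

End Liouville.

(** * Reduction to two variables *)

Section Reduction.
Variables (R : realType) (n : nat).
Local Notation V := 'rV[R]_n.+1.
Local Notation e j := (@delta_mx R 1 n.+1 0 j).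
Implicit Types (x y v : V) (u : V -> R).

Lemma gradient_eq0_constant u : (forall j x, is_derive x (e j) u 0) ->
  forall x y, u x = u y.
Proof.
move=> du x y; have [xi _] := @mean_value_coordinates _ _ u (fun _ _ => 0) y (x - y) du.
rewrite [y + _]addrC subrK big1 => [/subr0_eq //|j _]; exact: mulr0.
Qed.

(** The mean value theorem in coordinates evaluates the derivatives at nearby but different
    points, so the increment is [h] times an oscillation of [partial l u], that is, [o(h)]. *)
Lemma constant_along u (c : 'I_n.+1 -> R) (l : 'I_n.+1) v : C1 u ->
  (forall i x, i != ord0 -> partial i u x = c i * partial l u x) ->
  v 0 ord0 = 0 -> \sum_(i | i != ord0) v 0 i * c i = 0 ->
  forall x, u (x + v) = u x.
Proof.
move=> C1u pc v0 vc x; have [_ cpu du] := C1_gradient C1u.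
pose f (t : R) := u (x + t *: v).
suff df t : is_derive t (1 : R) f 0.
  have := @is_derive_0_is_cst _ f 1 0 df.
  by rewrite /f scale1r scale0r addr0.
apply: is_derive_of_estimate => eps eps0.
pose S := \sum_(i | i != ord0) `|v 0 i * c i| + 1.
have S0 : 0 < S by rewrite ltr_wpDl // sumr_ge0.
have [d d0 hd] := continuous_ball_le (x + t *: v) (cpu l) (divr_gt0 eps0 S0).
have v10 : 0 < `|v| + 1 by rewrite ltr_wpDl.
exists (d / (`|v| + 1)); first by rewrite divr_gt0.
move=> h hh; rewrite mulr0 subr0 /f.
have [xi hxi] := mean_value_coordinates (x + t *: v) (h *: v) du.
rewrite -addrA -scalerDl => ->.
have near_xi j : `|partial l u (xi j) - partial l u (x + t *: v)| <= eps / S.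
  apply: hd; apply: le_trans (hxi j) _; rewrite normrZ.
  apply: (@le_trans _ _ (d / (`|v| + 1) * (`|v| + 1))); last by rewrite divfK ?gt_eqF.
  by apply: ler_pM => //; rewrite lerDl.
have -> : \sum_j (h *: v) 0 j * partial j u (xi j) = h * \sum_(j | j != ord0)
    v 0 j * c j * (partial l u (xi j) - partial l u (x + t *: v)).
  transitivity (h * \sum_(j | j != ord0) v 0 j * c j * partial l u (xi j)).
    rewrite (bigD1 ord0) // [(h *: v) 0 ord0]mxE v0 mulr0 mul0r /= add0r mulr_sumr.
    by apply: eq_bigr => j j0; rewrite mxE pc // !mulrA.
  congr (h * _); under [RHS]eq_bigr do rewrite mulrBr.
  by rewrite sumrB -mulr_suml vc mul0r subr0.
rewrite normrM mulrC; apply: ler_wpM2r => //.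
apply: le_trans (ler_norm_sum _ _ _) _.
apply: (@le_trans _ _ (\sum_(i | i != ord0) `|v 0 i * c i| * (eps / S))).
  by apply: ler_sum => j _; rewrite normrM; apply: ler_wpM2l.
rewrite -mulr_suml mulrCA ger_pMr // ler_pdivrMr // mul1r.
by rewrite /S lerDl.
Qed.

Lemma two_dimensional_of_gradient u (c : 'I_n.+1 -> R) (l : 'I_n.+1) : C1 u ->
  l != ord0 -> c l = 1 ->
  (forall i x, i != ord0 -> partial i u x = c i * partial l u x) ->
  at_most_dimensional 2 u.
Proof.
move=> C1u l0 cl pc.
pose P : 'M[R]_(n.+1, 2) := \matrix_(i, k)
  (if k == ord0 then (i == ord0)%:R else if i == ord0 then 0 else c i).
exists (mulmxr P).
exists (fun y : 'rV[R]_2 => u (y 0 ord0 *: e ord0 + y 0 ord_max *: e l)).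
apply/funext => x /=.
have P0 : (x *m P) 0 ord0 = x 0 ord0.
  rewrite !mxE (bigD1 ord0) //= !mxE eqxx mulr1 big1 ?addr0 // => j /negbTE j0.
  by rewrite !mxE eqxx j0 mulr0.
have P1 : (x *m P) 0 ord_max = \sum_(i | i != ord0) x 0 i * c i.
  rewrite !mxE (bigD1 ord0) //= !mxE /= mulr0 add0r.
  by apply: eq_bigr => j /negbTE j0; rewrite !mxE /= j0.
rewrite P0 P1; set s := \sum_(i | _) _.
set z := _ + _; rewrite -{1}[x](subrK z) addrC.
apply: (constant_along C1u pc).
  by rewrite !mxE eqxx eq_sym (negbTE l0) /= mulr1 mulr0 addr0 subrr.
have -> : \sum_(i | i != ord0) (x - z) 0 i * c i =
    \sum_(i | i != ord0) (x 0 i * c i - s * (i == l)%:R).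
  apply: eq_bigr => i i0; rewrite !mxE /= (negbTE i0) mulr0 add0r.
  by have [->|_] := eqVneq i l; rewrite ?cl ?mulr1 ?mulr0 ?subr0.
rewrite sumrB -/s -mulr_sumr (bigD1 l) //= eqxx big1 ?addr0 ?mulr1 ?subrr //.
by move=> i /andP[_ /negbTE ->].
Qed.

End Reduction.

(** * Limits in the last direction and volume growth *)

Section Profile.
Variables (R : realType) (n : nat).
Local Notation V := 'rV[R]_n.+1.
Local Notation e j := (@delta_mx R 1 n.+1 0 j).
Implicit Types (x : V) (u : V -> R).

Lemma rcons_rV_line (y : 'rV[R]_n) (s t : R) :
  rcons_rV y s + t *: e ord_max = rcons_rV y (s + t).
Proof.
apply/rowP => j; rewrite !mxE eqxx /=.
case: unliftP => [k ->|->] /=; last by rewrite eqxx mulr1.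
by rewrite eq_sym (negbTE (neq_lift _ _)) mulr0 addr0.
Qed.

Lemma rcons_rV_eta x : x = rcons_rV (\row_j x 0 (lift ord_max j)) (x 0 ord_max).
Proof.
by apply/rowP => j; rewrite !mxE; case: unliftP => [k ->|->] //=; rewrite mxE.
Qed.

Lemma monotone_convergent_limit u : asymptotically_convergent u ->
  forall x (s : R), 0 < s -> exists T : R, 1 - u (x + T *: e ord_max) <= s.
Proof.
move=> conv x s s0; rewrite {1}[x]rcons_rV_eta; set y := \row_j _.
have [h _] := conv y; move/cvgrPdist_le : h => /(_ _ s0) h.
near (pinfty_nbhs R) => t.
exists (t - x 0 ord_max); rewrite rcons_rV_line [_ + (t - _)]addrC subrK.
apply: le_trans (ler_norm _) _.
by near: t.
Unshelve. all: by end_near. Qed.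

Lemma monotone_convergent_abs_le1 (a : R -> R) u : classical_solution a u ->
  monotone_solution u -> asymptotically_convergent u -> forall x, `|u x| <= 1.
Proof.
move=> sol mono conv x; rewrite [x]rcons_rV_eta; set y := \row_j _; set s := x 0 _.
have [h1 h2] := conv y.
have inc t t' : t <= t' -> u (rcons_rV y t) <= u (rcons_rV y t').
  move=> tt'; have := monotone_line sol mono (rcons_rV y 0) tt'.
  by rewrite !rcons_rV_line !add0r.
rewrite ler_norml; apply/andP; split.
  apply: (cvgr_to_le h2); near=> t; apply: inc.
  by near: t; apply: nbhs_ninfty_le; exact: num_real.
apply: (cvgr_to_ge h1); near=> t; apply: inc.
by near: t; apply: nbhs_pinfty_ge; exact: num_real.
Unshelve. all: by end_near. Qed.

(** With [r = 2 ^ j], the cutoff is carried by the cube of half-side [16 r], and the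
    growth condition is used at [32 r]. The integral is of the order of
    [r ^ n * r ^ (1 - eps) * g (32 r)], and the restriction on the dimension says that
    the power of [r] is at most cubic. *)
Lemma weighted_volume_le (a g : R -> R) (M k eps : R) (L : R) (j : nat) :
  continuous a -> (forall t, `|a t| <= M) -> classG g -> n.+1%:R <= 3 + eps ->
  0 <= eps -> eps <= 1 ->
  (forall r : R, 1 < r ->
     (\int[lebesgue_measure]_(x in `[(- r)%R, r]) (drift_weight a x)%:E
       <= (k * r `^ (1 - eps) * g r)%:E)%E) -> 0 < L ->
  integral L (fun x : V => weight (drift_weight a) x * cutoff (8 * 2 ^+ j) x) <=
    expR M * `|k| * 32 * 33 ^+ n * (2 ^+ j) ^+ 3 * g (2 ^+ (j + 5)).
Proof.
move=> ca aM [g0 _ _] dim eps0 eps1 growth L0; set r : R := 2 ^+ j.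
have r1 : 1 <= r by rewrite exprn_ege1 // ler1n.
have r0 : 0 < r by exact: lt_le_trans r1.
have r32 : 2 ^+ (j + 5) = 32 * r :> R.
  by rewrite exprD mulrC; congr (_ * _); rewrite -natrX.
rewrite r32.
have rgt1 : 1 < 32 * r by lra.
have [G [Gmono Gom GL]] := drift_weight_primitive ca aM (ltW rgt1) (growth _ rgt1).
have cw := continuous_weight (n := n) ca (fun t => drift_weight_derive t ca).
have [cc _ _] := cutoff_gradient n (8 * r).
have w0 x : 0 < weight (drift_weight a) x by exact: drift_weight_gt0.
have r8 : 0 < 8 * r by rewrite mulr_gt0.
have r16 : 0 <= 16 * r by rewrite mulr_ge0 // ltW.
apply: (@le_trans _ _ ((G L - G (- L)) * (2 * (16 * r) + 1) ^+ n)).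
  apply: (@integral_le_cube _ _ _ L0 _ (drift_weight a)) => //.
  - by cts.
  - by move=> t; exact: ltW (drift_weight_gt0 a t).
  - by move=> t h ht; apply: Gom; apply: le_trans ht _; lra.
  - move=> x _; have /andP[_ c1] := cutoff_in01 (8 * r) x.
    by rewrite -[leRHS]mulr1; apply: ler_wpM2l => //; exact: ltW.
  - move=> x hx; rewrite cutoff_support ?mulr0 //.
    by apply: le_trans (ltW hx); lra.
have gr0 : 0 < g (32 * r) by apply: g0; lra.
have powle : (32 * r) `^ (1 - eps) * r ^+ n <= 32 * r ^+ 3.
  rewrite powRM ?(ltW r0) // -mulrA; apply: ler_pM; rewrite ?powR_ge0 //.
  - by rewrite mulr_ge0 ?powR_ge0 // exprn_ge0 // ltW.
  - have : 32 `^ (1 - eps) <= 32 `^ 1 :> R by apply: ler_powR; lra.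
    by rewrite powRr1.
  rewrite -!powR_mulrn ?(ltW r0) // -powRD; last by rewrite (lt0r_neq0 r0) implybT.
  by apply: ler_powR => //; move: dim; rewrite -natr1; lra.
have kk : k * (32 * r) `^ (1 - eps) * g (32 * r) <=
    `|k| * (32 * r) `^ (1 - eps) * g (32 * r).
  rewrite ler_wpM2r ?(ltW gr0) // ler_wpM2r ?powR_ge0 //; exact: ler_norm.
have eM : 0 <= expR M by exact: expR_ge0.
apply: (@le_trans _ _ (expR M * (`|k| * (32 * r) `^ (1 - eps) * g (32 * r)) * (33 * r) ^+ n)).
  apply: ler_pM.
  - by rewrite subr_ge0; apply: Gmono; rewrite ge0_cp // ltW.
  - by rewrite exprn_ge0 // addr_ge0 // mulr_ge0.
  - by apply: le_trans (GL L) _; apply: ler_wpM2l.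
  - by apply: lerXn2r; rewrite ?nnegrE; lra.
rewrite exprMn.
have -> : expR M * (`|k| * (32 * r) `^ (1 - eps) * g (32 * r)) * (33 ^+ n * r ^+ n) =
  expR M * `|k| * 33 ^+ n * g (32 * r) * ((32 * r) `^ (1 - eps) * r ^+ n) by ring.
have -> : expR M * `|k| * 32 * 33 ^+ n * r ^+ 3 * g (32 * r) =
  expR M * `|k| * 33 ^+ n * g (32 * r) * (32 * r ^+ 3) by ring.
by apply: ler_wpM2l => //; rewrite !mulr_ge0 ?exprn_ge0 // ltW.
Qed.

End Profile.


(** * The symmetry theorem *)

(* The dimension n >= 2 is m.+2. *)
Theorem corollary1 (R : realType) (m : nat) (a : R -> R) (eps : R)
    (a_bounded : a \in Lfun (@lebesgue_measure R) +oo%E)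
    (a_smooth : smooth a)
    (eps_ge0 : 0 <= eps) (eps_le1 : eps <= 1)
    (a_growth : exists (g : R -> R) (k : R), classG g /\
       forall r : R, 1 < r ->
         (\int[lebesgue_measure]_(x in `[(- r)%R, r])
              (expR (- oriented_integral a 0 x))%:E
            <= (k * r `^ (1 - eps) * g r)%:E)%E)
    (dim_le : (m.+2)%:R <= 3 + eps)
    (u : 'rV[R]_m.+2 -> R)
    (u_sol : classical_solution a u)
    (u_mono : monotone_solution u)
    (u_conv : asymptotically_convergent u) :
  at_most_dimensional 2 u.
Proof.
have ca := smooth_continuous a_smooth.
have [M M0 aM] := essentially_bounded_continuous a_bounded ca.
have u_abs := monotone_convergent_abs_le1 u_sol u_mono u_conv.
have u_lim := monotone_convergent_limit u_conv.
have grad := gradient_bound u_sol M0 aM u_abs.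
have [g [k [Gg growth]]] := a_growth.
have l0 : (ord_max : 'I_m.+2) != ord0 by [].
have dw t := drift_weight_derive t ca.
have flat i (i0 : i != ord0) := @slope_gradient_eq0 R m.+1 a (drift_weight a) ca
  (drift_weight_gt0 a) dw u _ ord_max i u_sol l0 i0 u_abs grad u_mono u_lim g
  (expR M * `|k| * 32 * 33 ^+ m.+1) (fun t t0 => let: And3 h _ _ := Gg in h t t0)
  (classG_sum_unbounded Gg)
  (fun L j => weighted_volume_le j ca aM Gg dim_le eps_ge0 eps_le1 growth).
have K0 : 0 <= expR M * `|k| * 32 * 33 ^+ m.+1.
  by rewrite !mulr_ge0 ?expR_ge0 // exprn_ge0.
have p0 x : partial ord_max u x != 0 by exact: lt0r_neq0 (u_mono x).
have slope_cst i x : i != ord0 -> slope u ord_max i x = slope u ord_max i 0.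
  move=> i0; have [_ _ ds] := slope_gradient i u_sol u_mono.
  by apply: gradient_eq0_constant => j y; rewrite -(flat i i0 K0 j y).
apply: (@two_dimensional_of_gradient _ _ u (fun i => slope u ord_max i 0) ord_max) => //.
- exact: solution_C1 u_sol.
- by rewrite /slope divff.
- by move=> i x i0; rewrite -(slope_cst i x i0) /slope divfK.
Qed.
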